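(* Let $E$ be a nonzero real Banach space and $S\colon E\rightrightarrows E^*$ be maximally monotone. Then the following are equivalent: (a) $S$ is quasidense; (b) $S$ is of type (FP); (c) for all $(w^*,w^{**})\in E^*\times E^{**}$, $\inf_{(s,s^* )\in G(S)}\langle s^*-w^*,\widehat s-w^{**}\rangle\le0$.
   Context: $\widehat s\in E^{**}$ is the canonical image of $s\in E$. $S$ (with nonempty graph $G(S)$ and range $R(S)$) is monotone if $\langle s-t,s^*-t^*\rangle\ge0$ on $G(S)$, maximally monotone if no monotone multifunction has a strictly larger graph; quasidense if for every $(x,x^* )\in E\times E^*$, $\inf_{(s,s^* )\in G(S)}[\tfrac12\|s-x\|^2+\tfrac12\|s^*-x^*\|^2+\langle s-x,s^*-x^*\rangle]\le0$. A monotone $S$ is of type (FP) if whenever $\widetilde U$ is an open convex subset of $E^*$ with $\widetilde U\cap R(S)\ne\emptyset$, $(w,w^* )\in E\times\widetilde U$, and $\langle s-w,s^*-w^*\rangle\ge0$ for all $(s,s^* )\in G(S)$ with $s^*\in\widetilde U$, then $(w,w^* )\in G(S)$. *)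

(* Defs.v *)
From HB Require Import structures.
From mathcomp Require Import all_boot all_order all_algebra.
From mathcomp Require Import all_classical all_reals all_analysis.
Set Implicit Arguments. Unset Strict Implicit. Unset Printing Implicit Defensive.
Import Order.TTheory GRing.Theory Num.Theory.
Import numFieldNormedType.Exports.
Local Open Scope classical_set_scope.
Local Open Scope ring_scope.

Section Duality.
Variables (R : realType) (E : normedModType R).

Definition is_dual (f : E -> R) : Prop :=
  (forall (a : R) (x y : E), f (a *: x + y) = a * f x + f y) /\ continuous f.

Definition dnorm (f : E -> R) : R := sup [set `|f x| | x in [set x : E | `|x| <= 1]].

Definition dsub (f g : E -> R) : E -> R := fun x => f x - g x.

Definition is_bidual (w : (E -> R) -> R) : Prop :=
  (forall (a : R) (f g : E -> R), is_dual f -> is_dual g ->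
      w (fun x => a * f x + g x) = a * w f + w g) /\
  (exists C : R, forall f, is_dual f -> `|w f| <= C * dnorm f).

Definition hat (s : E) : (E -> R) -> R := fun f => f s.

Definition is_multifunction (G : set (E * (E -> R))) : Prop :=
  (forall p, G p -> is_dual p.2) /\ (exists p, G p).

Definition monotone (G : set (E * (E -> R))) : Prop :=
  forall s t, G s -> G t -> 0 <= (dsub s.2 t.2) (s.1 - t.1).

Definition maximally_monotone (G : set (E * (E -> R))) : Prop :=
  is_multifunction G /\ monotone G /\
  forall G' : set (E * (E -> R)), is_multifunction G' -> monotone G' ->
    G `<=` G' -> G' = G.

Definition quasidense (G : set (E * (E -> R))) : Prop :=
  forall (x : E) (xs : E -> R), is_dual xs ->
    (ereal_inf [set ((1/2) * `|s.1 - x| ^+ 2 + (1/2) * dnorm (dsub s.2 xs) ^+ 2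
                     + dsub s.2 xs (s.1 - x))%:E | s in G] <= 0)%E.

Definition dual_open (U : set (E -> R)) : Prop :=
  forall f, U f -> exists2 e : R, 0 < e &
    forall g, is_dual g -> dnorm (dsub g f) < e -> U g.

Definition dual_convex (U : set (E -> R)) : Prop :=
  forall f g (t : R), U f -> U g -> 0 <= t <= 1 ->
    U (fun x => t * f x + (1 - t) * g x).

Definition type_FP (G : set (E * (E -> R))) : Prop :=
  forall U : set (E -> R),
    (forall f, U f -> is_dual f) -> dual_open U -> dual_convex U ->
    (exists s, G s /\ U s.2) ->
    forall (w : E) (ws : E -> R), U ws ->
      (forall s, G s -> U s.2 -> 0 <= dsub s.2 ws (s.1 - w)) ->
      G (w, ws).

Definition cond_c (G : set (E * (E -> R))) : Prop :=
  forall (ws : E -> R) (wss : (E -> R) -> R), is_dual ws -> is_bidual wss ->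
    (ereal_inf [set (hat s.1 (dsub s.2 ws) - wss (dsub s.2 ws))%:E | s in G]
       <= 0)%E.

End Duality.

(* Main.v *)
(* Write x' and x'' for elements of the dual and of the bidual. Condition (c) is
   the hub. It follows from (a) by testing quasidensity at (0, w' + d), where d
   is an approximate duality map of w'', and from (b) by taking for U a thin
   tube around a segment joining w' to a point t' of R(S), and for w a vector at
   which t' - w' takes the value w''(t' - w').

   Conversely, let p be the convex hull of the duality product restricted to
   G(S), and let j be a convex function on E with conjugate k. Hahn-Banach
   separation of p from the concave function - k(x') - j(- x) produces a pair
   (w', w'') violating (c) unless the infimum of p(x, x') + k(x') + j(- x) is at
   most 0. With j(x) = |x|^2 / 2, recentred at successive points, this yields a
   Cauchy sequence whose limit lies in G(S) by maximality: every point where p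
   exceeds the duality product by at most a^2 is within 4 a of G(S). This gives
   (a). For (b), recentre at (w, w') and take
   j(x) = delta |x| + max(0, <x, t' - w'> - 1), where t' is a point of R(S) in U:
   the domain of k is then a tube inside U, which forces the approximate
   minimisers towards 0 in E and into a small multiple of the delta-ball of the
   dual, and monotonicity shows that (w, w') is monotonically related to G(S). *)
Require Import Defs.
From HB Require Import structures.
From mathcomp Require Import all_boot all_order all_algebra.
From mathcomp Require Import all_classical all_reals all_analysis.
From mathcomp Require Import ring lra.
Set Implicit Arguments. Unset Strict Implicit. Unset Printing Implicit Defensive.
Import Order.TTheory GRing.Theory Num.Theory.
Import numFieldNormedType.Exports.
Local Open Scope classical_set_scope.
Local Open Scope ring_scope.

(** * Continuous linear forms and the dual norm *)

Section dual_space.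
Variables (R : realType) (E : normedModType R).
Implicit Types (f g : E -> R) (x y : E) (a : R).

Lemma dual0 f : is_dual f -> f 0 = 0.
Proof. by case=> /(_ 1 0 0); rewrite scaler0 addr0 mul1r => h _; lra. Qed.

Lemma dualZ f (df : is_dual f) a x : f (a *: x) = a * f x.
Proof. by rewrite -[a *: x]addr0 df.1 (dual0 df) addr0. Qed.

Lemma dualD f (df : is_dual f) x y : f (x + y) = f x + f y.
Proof. by rewrite -[x in LHS]scale1r df.1 mul1r. Qed.

Lemma dualN f (df : is_dual f) x : f (- x) = - f x.
Proof. by rewrite -scaleN1r dualZ// mulN1r. Qed.

Lemma dualB f (df : is_dual f) x y : f (x - y) = f x - f y.
Proof. by rewrite dualD// dualN. Qed.

(** Homogeneity carries the bound from the unit ball to [E], and replacing [x] by [- x] makes it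
    two-sided. *)
Lemma linear_form_bound f C :
  (forall a x y, f (a *: x + y) = a * f x + f y) ->
  (forall x, `|x| <= 1 -> f x <= C) -> forall x, `|f x| <= C * `|x|.
Proof.
move=> lf fC x.
have f0 : f 0 = 0 by have := lf 1 0 0; rewrite scaler0 addr0 mul1r => h; lra.
have fZ a y : f (a *: y) = a * f y by rewrite -[a *: y]addr0 lf f0 addr0.
have ub y : f y <= C * `|y|.
  have [->|y0] := eqVneq y 0; first by rewrite f0 normr0 mulr0.
  have ny : 0 < `|y| by rewrite normr_gt0.
  have /fC : `| `|y|^-1 *: y| <= 1.
    by rewrite normrZ ger0_norm ?invr_ge0// mulVf// gt_eqF.
  by rewrite fZ mulrC ler_pdivrMr.
rewrite ler_norml ub andbT lerNl.
by have := ub (- x); rewrite -scaleN1r fZ mulN1r normrZ normrN1 mul1r.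
Qed.

Lemma is_dual_bounded f C :
  (forall a x y, f (a *: x + y) = a * f x + f y) ->
  (forall x, `|f x| <= C * `|x|) -> is_dual f.
Proof.
move=> lf fC; split=> // x.
have fB y : f x - f y = f (x - y).
  by rewrite [x - y]addrC -[- y]scaleN1r lf mulN1r addrC.
have C0 : 0 < `|C| + 1 by rewrite ltr_wpDl.
apply/cvgrPdist_lt => e e0; near=> y.
rewrite fB (le_lt_trans (fC _))//.
rewrite (@le_lt_trans _ _ ((`|C| + 1) * `|x - y|))//.
  by rewrite ler_wpM2r// (le_trans (ler_norm _))// lerDl.
rewrite mulrC -ltr_pdivlMr//; near: y.
by apply: (@cvgr_dist_lt _ _ _ (nbhs x)) => //; rewrite divr_gt0.
Unshelve. all: by end_near. Qed.

Lemma dual_bounded f : is_dual f -> exists C, forall x, `|f x| <= C * `|x|.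
Proof.
move=> [lf cf].
have /cvgrPdist_lt /(_ 1 ltr01) := cf 0.
rewrite (dual0 (conj lf cf)) => /nbhs_norm0P [e /= e0 efM].
(* On the open ball of radius [e], [|f| < 1]; the factor [e / 2] maps the closed unit ball into
   it. *)
exists (2 / e); apply: linear_form_bound => // x x1.
have : `|f ((e / 2) *: x)| < 1.
  rewrite -normrN -sub0r; apply: efM => /=.
  rewrite normrZ gtr0_norm ?divr_gt0//.
  by rewrite (le_lt_trans (ler_piMr _ _))//; lra.
rewrite (dualZ (conj lf cf)) => /ltr_normlW.
rewrite ler_pdivlMr// => h; lra.
Qed.

Lemma dnorm_ge0 f : 0 <= dnorm f.
Proof.
rewrite /dnorm; set A := [set _ | _ in _].
(* A set without supremum gets the default [sup] equal to [0], which settles an unbounded [f]. *)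
have [hA|hA] := pselect (has_sup A); last by rewrite sup_out.
apply: (@le_trans _ _ `|f 0|) => //; apply: ub_le_sup; first by case: hA.
by exists 0 => //=; rewrite normr0.
Qed.

Lemma dnorm_ub f x : is_dual f -> `|f x| <= dnorm f * `|x|.
Proof.
move=> df; apply: linear_form_bound; first by case: df.
move=> {}x x1; apply: (le_trans (ler_norm _)); apply: ub_le_sup.
  have [C fC] := dual_bounded df.
  exists `|C| => _ [y /= y1 <-]; apply: (le_trans (fC y)).
  rewrite (le_trans (ler_wpM2r _ (ler_norm C)))//.
  by rewrite ler_piMr.
by exists x.
Qed.

Lemma dnorm_le f C : (forall x, `|x| <= 1 -> `|f x| <= C) -> dnorm f <= C.
Proof.
move=> fC; apply: ge_sup; first by exists `|f 0|, 0 => //=; rewrite normr0.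
by move=> _ [x /= x1 <-]; exact: fC.
Qed.

Lemma dnorm_le_bound f C : 0 <= C -> (forall x, `|f x| <= C * `|x|) -> dnorm f <= C.
Proof.
by move=> C0 fC; apply: dnorm_le => x x1; rewrite (le_trans (fC x))// ler_piMr.
Qed.

Lemma dnorm_approx f e : is_dual f -> 0 < e ->
  exists2 x, `|x| <= 1 & dnorm f - e < f x.
Proof.
move=> df e0; apply: contrapT => h.
suff : dnorm f <= dnorm f - e by lra.
apply: dnorm_le_bound => [|x]; last first.
  apply: linear_form_bound => [|y y1]; first by case: df.
  by rewrite leNgt; apply/negP => fy; apply: h; exists y.
(* A negative [dnorm f - e] would already be exceeded by [f 0 = 0]. *)
rewrite leNgt; apply/negP => ne; apply: h; exists 0; rewrite ?normr0//.
by rewrite dual0.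
Qed.

Lemma is_dual_comb f g a : is_dual f -> is_dual g ->
  is_dual (fun x => a * f x + g x).
Proof.
move=> df dg; apply: (@is_dual_bounded _ (`|a| * dnorm f + dnorm g)).
  by move=> b x y; rewrite !(df.1, dg.1); ring.
move=> x; rewrite (le_trans (ler_normD _ _))// mulrDl lerD ?dnorm_ub//.
by rewrite normrM -mulrA ler_wpM2l// dnorm_ub.
Qed.

Lemma is_dual_dsub f g : is_dual f -> is_dual g -> is_dual (dsub f g).
Proof.
move=> df dg.
suff -> : dsub f g = fun x => -1 * g x + f x by exact: is_dual_comb.
by apply/funext => x; rewrite /dsub; ring.
Qed.

Lemma is_dual_add f g : is_dual f -> is_dual g -> is_dual (fun x => f x + g x).
Proof.
move=> df dg.
suff -> : (fun x => f x + g x) = fun x => 1 * f x + g x by exact: is_dual_comb.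
by apply/funext => x; ring.
Qed.

Lemma is_dual_scale f a : is_dual f -> is_dual (fun x => a * f x).
Proof.
move=> df; suff -> : (fun x => a * f x) = fun x => (a - 1) * f x + f x.
  exact: is_dual_comb.
by apply/funext => x; ring.
Qed.

Lemma is_dual0 : is_dual (fun _ : E => 0 : R).
Proof.
by apply: (@is_dual_bounded _ 0) => [*|x]; [rewrite mulr0 addr0|rewrite normr0 mul0r].
Qed.

End dual_space.

(** * Sequences with geometrically decreasing steps *)

Section geometric_cauchy.
Variable R : realType.

Lemma half_pow_lt (C e : R) : 0 < e -> exists N : nat, C / 2 ^+ N < e.
Proof.
move=> e0; pose N := Num.bound `|C / e|.
exists N; rewrite ltr_pdivrMr ?exprn_gt0//.
have h : `|C / e| < N%:R by exact: archi_boundP (normr_ge0 _).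
rewrite -ltr_pdivrMl// mulrC (le_lt_trans (ler_norm _))// (lt_trans h)//.
by rewrite -natrX ltr_nat ltn_expl.
Qed.

Lemma le0_half_pow (x C : R) : (forall n, x <= C / 2 ^+ n) -> x <= 0.
Proof.
move=> h; rewrite leNgt; apply/negP => /(half_pow_lt C)[N].
by rewrite ltNge h.
Qed.

Lemma geometric_limit (V : completeNormedModType R) (u : nat -> V) (A : R) :
  (forall n, `|u n.+1 - u n| <= A / 2 ^+ n) ->
  exists l, forall n, `|l - u n| <= 2 * A / 2 ^+ n.
Proof.
move=> uA.
have A0 : 0 <= A by have := le_trans (normr_ge0 _) (uA 0%N); rewrite expr0 divr1.
have tail n m : `|u (n + m)%N - u n| <= 2 * A / 2 ^+ n.
  (* The subtracted term closes the induction: it shrinks by [A / 2 ^+ (n + m)], the cost of one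
     step. *)
  suff : `|u (n + m)%N - u n| <= 2 * A / 2 ^+ n - 2 * A / 2 ^+ (n + m).
    move=> h; apply: (le_trans h); rewrite gerBl.
    by rewrite divr_ge0 ?exprn_ge0// mulr_ge0.
  elim: m => [|m ih]; first by rewrite addn0 !subrr normr0.
  rewrite addnS (le_trans (ler_distD (u (n + m)%N) _ _))//.
  apply: (le_trans (lerD (uA _) ih)); rewrite exprS.
  have : (2 : R) ^+ (n + m) != 0 by rewrite expf_neq0.
  move=> nz; rewrite [in leRHS]invfM; move: (_^-1) (_^-1) => p q; lra.
have cu : cauchy_ex (u @ \oo).
  move=> e e0; have [N hN] := half_pow_lt (2 * A) e0.
  exists (u N); exists N => // n /= Nn.
  rewrite -ball_normE /= distrC -(subnKC Nn).
  exact: le_lt_trans (tail _ _) hN.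
have /cauchy_cvgP/cvg_ex[l ul] : cauchy (u @ \oo) by exact: cauchy_exP.
exists l => n; apply/ler_addgt0Pr => e e0.
have /cvgrPdist_lt /(_ e e0)[N _ hN] := ul.
have := hN (n + N)%N (leq_addl _ _) => /= h.
apply: (le_trans (ler_distD (u (n + N)%N) _ _)).
by rewrite addrC; apply: lerD; [exact: tail|exact: ltW].
Qed.

End geometric_cauchy.

(** * Completeness of the dual *)

Section dual_complete.
Variables (R : realType) (E : normedModType R).

Lemma dual_geometric_limit (f : nat -> E -> R) (A : R) :
  (forall n, is_dual (f n)) ->
  (forall n, dnorm (dsub (f n.+1) (f n)) <= A / 2 ^+ n) ->
  exists2 l, is_dual l & forall n, dnorm (dsub l (f n)) <= 2 * A / 2 ^+ n.
Proof.
move=> df fA.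
have A0 : 0 <= A.
  by have := le_trans (dnorm_ge0 _) (fA 0%N); rewrite expr0 divr1.
(* The limit is pointwise but keeps its rate: the linearity defect is then at most a constant over
   [2 ^+ n] for every [n], and the rate is uniform on the unit ball. *)
have /choice[l lf] x : exists l : R, forall n, `|l - f n x| <= 2 * A * `|x| / 2 ^+ n.
  have [n|l hl] := @geometric_limit R R^o (fun n => f n x) (A * `|x|).
    have := dnorm_ub x (is_dual_dsub (df n.+1) (df n)).
    move=> /le_trans; apply; rewrite mulrAC ler_wpM2r//.
  by exists l => n; have := hl n; rewrite mulrA.
have ll a x y : l (a *: x + y) = a * l x + l y.
  apply/eqP; rewrite -subr_eq0 -normr_le0.
  apply: (@le0_half_pow _ _ (2 * A * (`|a *: x + y| + `|a| * `|x| + `|y|))) => n.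
  have -> : l (a *: x + y) - (a * l x + l y) = (l (a *: x + y) - f n (a *: x + y))
     - a * (l x - f n x) - (l y - f n y) by rewrite (df n).1; ring.
  rewrite (le_trans (ler_normB _ _))// [leRHS]mulrAC [leRHS]mulrDr lerD//; last by rewrite mulrAC.
  rewrite (le_trans (ler_normB _ _))// [leRHS]mulrDr lerD//; first by rewrite mulrAC.
  rewrite normrM [leRHS]mulrCA ler_wpM2l//.
  by have := lf x n; rewrite mulrAC.
have bound n x : `|l x - f n x| <= 2 * A / 2 ^+ n * `|x|.
  by rewrite mulrAC.
exists l.
  apply: (@is_dual_bounded _ _ _ (2 * A + dnorm (f 0%N))) => // x.
  rewrite -[l x](subrK (f 0%N x)) (le_trans (ler_normD _ _))// mulrDl lerD//.
    by have := bound 0%N x; rewrite expr0 divr1.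
  exact: dnorm_ub.
move=> n; apply: dnorm_le_bound; last exact: bound.
by rewrite divr_ge0 ?exprn_ge0// mulr_ge0.
Qed.

End dual_complete.

(** * Separation of a convex cone from a vertical half-line *)

Section cone_separation.
Variables (R : realType) (V : lmodType R).
Let W : lmodType R := (V * R^o)%type.
Implicit Types (P Q A : set W) (v w : V) (a t : R).

Definition convex_cone P :=
  [/\ P 0, forall p q, P p -> P q -> P (p + q)
    & forall a p, 0 < a -> P p -> P (a *: p)].

Let lower P Q := [/\ convex_cone Q, forall a, Q (0, a) -> 0 <= a
  & forall p, Q p -> exists a, P (p.1, a)].

(** Zorn's lemma is applied to the sets [A] whose union with [P] is admissible, so that the empty
    chain, with union [set0], is covered too. *)
Let maximal_lower P : lower P P ->
  exists2 Q, P `<=` Q & lower P Q /\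
    forall B, Q `<=` B -> lower P B -> B `<=` Q.
Proof.
move=> lP; have [|A [lA maxA]] := @Zorn_bigcup W (fun A => lower P (A `|` P)).
  move=> F FP totF; set U := \bigcup_(X in F) X.
  have sub p q : (U `|` P) p -> (U `|` P) q -> exists A,
      [/\ lower P (A `|` P), (A `|` P) p, (A `|` P) q & A `<=` U].
    move=> [[A FA Ap]|Pp] [[B FB Bq]|Pq].
    - have [AB|BA] := totF A B FA FB.
      + by exists B; split; [exact: FP|left; exact: AB|left|exact: bigcup_sup].
      + by exists A; split; [exact: FP|left|left; exact: BA|exact: bigcup_sup].
    - by exists A; split; [exact: FP|left|right|exact: bigcup_sup].
    - by exists B; split; [exact: FP|right|left|exact: bigcup_sup].
    - by exists set0; split; [rewrite set0U|right|right|].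
  have lift A : A `<=` U -> A `|` P `<=` U `|` P by move=> AU; exact: setSU.
  split; first split.
  - by right; case: lP => -[].
  - move=> p q Up Uq; have [A [[[_ add _] _ _] Ap Aq AU]] := sub _ _ Up Uq.
    by apply: (lift A AU); exact: add.
  - move=> a p a0 Up; have [A [[[_ _ scl] _ _] Ap _ AU]] := sub _ _ Up Up.
    by apply: (lift A AU); exact: scl.
  - by move=> a Ua; have [A [[_ pos _] Aa _ _]] := sub _ _ Ua Ua; exact: pos.
  - by move=> p Up; have [A [[_ _ dom] Ap _ _]] := sub _ _ Up Up; exact: dom.
exists (A `|` P); first exact: subsetUr.
split=> // B QB lB; apply: contrapT => nBQ; apply: (maxA B).
  split; first by move=> p Ap; apply: QB; left.
  by move=> BA; apply: nBQ => p Bp; left; exact: BA.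
suff -> : B `|` P = B by [].
by apply/setUidPl => p Pp; apply: QB; right.
Qed.

(* A maximal cone [Q] not meeting the vertical half-line below [0] is the
   epigraph of a function [N]; maximality puts [(- y, - N y)] in [Q], so [N]
   is odd, hence linear. *)
Lemma cone_separation P :
  convex_cone P -> (forall a, P (0, a) -> 0 <= a) ->
  (forall p, P p -> exists a, P (- p.1, a)) ->
  exists L : V -> R, (forall p, P p -> L p.1 <= p.2) /\
    (forall a p q, P p -> P q -> L (a *: p.1 + q.1) = a * L p.1 + L q.1).
Proof.
move=> cP posP symP.
have [|Q PQ [[[Q0 QD QZ] Qpos Qdom] Qmax]] := @maximal_lower P.
  by split=> // -[v a] Pp; exists a.
have [P0 PD PZ] := cP.
(* By [symP] this projection of [P] is a linear subspace; the functional is built to be linear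
   there. *)
pose D v := exists a, P (v, a).
have D0 : D 0 by exists 0.
have DD v w : D v -> D w -> D (v + w).
  by move=> [a Pa] [b Pb]; exists (a + b); exact: PD Pa Pb.
have DN v : D v -> D (- v) by move=> [a /symP].
have DZ a v : D v -> D (a *: v).
  have pos b w : 0 < b -> D w -> D (b *: w).
    by move=> b0 [c Pc]; exists (b * c); exact: PZ b0 Pc.
  move=> Dv; have [a0|a0|->] := ltrgt0P a; last by rewrite scale0r.
  - exact: pos.
  - by rewrite -[a]opprK scaleNr -scalerN; apply: pos; [lra|exact: DN].
pose N v := inf [set a | Q (v, a)].
have Nset v : D v -> has_inf [set a | Q (v, a)].
  move=> Dv; split; first by have [a Pa] := Dv; exists a; exact: PQ.
  (* Adding a point of [Q] over [- v] lands on the vertical axis, which bounds the fibre over [v]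
     from below. *)
  have [b /PQ Qb] := DN _ Dv; exists (- b) => a /= Qa.
  have : 0 <= a + b by apply: Qpos; have := QD _ _ Qa Qb; rewrite /= -[0]/(0 : V) -(subrr v).
  lra.
have Nle v a : Q (v, a) -> N v <= a.
  by move=> Qa; apply: ge_inf => //; apply: (Nset v _).2; exact: Qdom Qa.
have Nlt v e : D v -> 0 < e -> exists2 a, Q (v, a) & a < N v + e.
  by move=> /Nset Dv e0; have [a Qa ae] := inf_adherent e0 Dv; exists a.
have N_add v w : D v -> D w -> N (v + w) <= N v + N w.
  move=> Dv Dw; apply/ler_addgt0Pr => e e0.
  have e2 : 0 < e / 2 by rewrite divr_gt0.
  have [a Qa ae] := Nlt v _ Dv e2; have [b Qb be] := Nlt w _ Dw e2.
  have := Nle _ _ (QD _ _ Qa Qb) => /= h; apply: (le_trans h).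
  lra.
have N0 : N 0 = 0.
  apply/eqP; rewrite eq_le Nle//=; apply: lb_le_inf; first exact: (Nset 0 _).1.
  by move=> a; exact: Qpos.
have N_scale a v : 0 < a -> D v -> N (a *: v) = a * N v.
  have le b w : 0 < b -> D w -> N (b *: w) <= b * N w.
    move=> b0 Dw; apply/ler_addgt0Pr => e e0.
    have [c Qc ce] := Nlt w _ Dw (divr_gt0 e0 b0).
    apply: (le_trans (Nle _ _ (QZ _ _ b0 Qc))) => /=.
    have := ltW ce; rewrite -(ler_pM2l b0) mulrDr [b * (e / b)]mulrC divfK//.
    by rewrite gt_eqF.
  move=> a0 Dv; apply/eqP; rewrite eq_le le//=.
  have ai : 0 < a^-1 by rewrite invr_gt0.
  have := le _ _ ai (DZ a _ Dv); rewrite scalerA mulVf ?gt_eqF// scale1r.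
  by rewrite mulrC ler_pdivlMr// mulrC.
have Nopp y : D y -> N (- y) = - N y.
  move=> Dy; apply/eqP; rewrite eq_le; apply/andP; split; last first.
    by have := N_add _ _ Dy (DN _ Dy); rewrite subrr N0; lra.
  apply: (Nle _ _); pose r : W := (y, N y).
  (* This is [Q] enlarged by the nonpositive multiples of [r]. On the vertical axis it stays above
     [0]: [(0, a) + t *: r] in [Q] gives [t * N y <= a + t * N y]. *)
  apply: (Qmax [set p : W | exists2 t, 0 <= t & Q (p + t *: r)]).
  - by move=> p Qp; exists 0 => //; rewrite scale0r addr0.
  - split; first split.
    + by exists 0 => //; rewrite scale0r addr0.
    + move=> p q [t t0 Qt] [u u0 Qu]; exists (t + u); first exact: addr_ge0.
      by rewrite scalerDl addrACA; exact: QD.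
    + move=> a p a0 [t t0 Qt]; exists (a * t); first by rewrite mulr_ge0// ltW.
      by rewrite -scalerA -scalerDr; exact: QZ.
    + move=> a [t]; rewrite le_eqVlt => /predU1P[<-|t0].
        by rewrite scale0r addr0; exact: Qpos.
      move=> /Nle /=; rewrite add0r N_scale//.
      by rewrite -[t *: N y]/(t * N y); lra.
    + move=> p [t t0 Qt]; have := Qdom _ Qt => /= Dp.
      have := DD _ _ Dp (DZ (- t) _ Dy).
      by rewrite scaleNr addrK.
  - exists 1 => //; rewrite scale1r; suff -> : (- y, - N y) + r = 0 :> W by [].
    by congr pair => /=; rewrite addNr.
have ND v w : D v -> D w -> N (v + w) = N v + N w.
  move=> Dv Dw; apply/eqP; rewrite eq_le N_add//=.
  by have := N_add _ _ (DD _ _ Dv Dw) (DN _ Dw); rewrite addrK Nopp//; lra.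
exists N; split=> [[v a]/PQ/Nle//|a [v b] [w c] /= Pv Pw].
have Dv : D v by exists b.
have Dw : D w by exists c.
rewrite ND//; last exact: DZ.
congr (_ + _); have [a0|a0|->] := ltrgt0P a.
- exact: N_scale.
- rewrite -[a in LHS]opprK scaleNr Nopp; last exact: DZ.
  by rewrite N_scale// ?mulNr ?opprK//; lra.
- by rewrite scale0r N0 mul0r.
Qed.

End cone_separation.


(** * The cone of a monotone graph and its translations *)

Section monotone_cone.
Variables (R : realType) (E : normedModType R).
Implicit Types (G : set (E * (E -> R))) (x s w : E) (f g ws : E -> R).

(* The convex cone generated by the points [(s, f, 1, f s)], [(s, f)] in [G];
   its section [t = 1] is the epigraph of the convex hull of the duality
   product restricted to [G]. *)
Inductive mcone G : E -> (E -> R) -> R -> R -> Prop :=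
| mcone0 : mcone G 0 (fun=> 0) 0 0
| mconeS s f a x g t r : G (s, f) -> 0 <= a -> mcone G x g t r ->
    mcone G (a *: s + x) (fun y => a * f y + g y) (a + t) (a * f s + r).

Definition dual_graph G := forall p, G p -> is_dual p.2.

Lemma mcone_dual G x f t r : dual_graph G -> mcone G x f t r -> is_dual f.
Proof.
move=> dG; elim=> [|s {}f a {}x g {}t {}r Gs a0 _ dg]; first exact: is_dual0.
by apply: is_dual_comb => //; exact: dG Gs.
Qed.

Lemma mcone_gen G s f : G (s, f) -> mcone G s f 1 (f s).
Proof.
move=> Gs; have := mconeS Gs ler01 (mcone0 G).
rewrite scale1r !addr0 mul1r; congr mcone.
by apply/funext => y; rewrite mul1r addr0.
Qed.

Lemma mconeD G x f t r x' f' t' r' : mcone G x f t r -> mcone G x' f' t' r' ->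
  mcone G (x + x') (fun y => f y + f' y) (t + t') (r + r').
Proof.
move=> + K'; elim=> [|s {}f a {}x g {}t {}r Gs a0 _ ih].
  by rewrite !add0r; move: K'; congr mcone; apply/funext => y; rewrite add0r.
rewrite -!addrA; have := mconeS Gs a0 ih; congr mcone.
by apply/funext => y; rewrite addrA.
Qed.

Lemma mconeZ G x f t r b : 0 <= b -> mcone G x f t r ->
  mcone G (b *: x) (fun y => b * f y) (b * t) (b * r).
Proof.
move=> b0; elim=> [|s {}f a {}x g {}t {}r Gs a0 _ ih].
  by rewrite scaler0 !mulr0; exact: mcone0.
rewrite scalerDr scalerA !mulrDr mulrA.
have := mconeS Gs (mulr_ge0 b0 a0) ih; congr mcone.
by apply/funext => y; rewrite mulrDr mulrA.
Qed.

(** The inequality is linear in each cone element, and on two generators it is monotonicity. Used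
    twice on one element with [t = 1], it says [f x <= r]: the convex hull dominates the duality
    product. *)
Lemma mcone_monotone G x f t r x' f' t' r' : dual_graph G -> Defs.monotone G ->
  mcone G x f t r -> mcone G x' f' t' r' -> f x' + f' x <= r * t' + r' * t.
Proof.
move=> dG mG K K'.
have gen s g : G (s, g) -> g x' + f' s <= g s * t' + r'.
  move=> Gs; have dg : is_dual g := dG _ Gs.
  elim: K' => [|u h a y k v q Gu a0 Ky ih]; first by rewrite (dual0 dg) mulr0 !addr0.
  have dh : is_dual h := dG _ Gu.
  have := mG _ _ Gs Gu; rewrite /dsub/= (dualB dg) (dualB dh) => m.
  have := mulr_ge0 a0 m; rewrite (dualD dg) (dualZ dg); lra.
have df' := mcone_dual dG K'.
elim: K => [|s g a y k v q Gs a0 Ky ih]; first by rewrite (dual0 df') mul0r mulr0 addr0.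
have := ler_wpM2l a0 (gen _ _ Gs); rewrite (dualD df') (dualZ df'); lra.
Qed.

(** Translation moving [(w, ws)] to the origin. *)
Definition shift w ws G : set (E * (E -> R)) :=
  [set p | G (p.1 + w, fun y => p.2 y + ws y)].

Lemma dual_graph_shift w ws G : is_dual ws -> dual_graph G ->
  dual_graph (shift w ws G).
Proof.
move=> dws dG [s f] /dG /= dfs.
suff -> : f = dsub (fun y => f y + ws y) ws by exact: is_dual_dsub.
by apply/funext => y; rewrite /dsub addrK.
Qed.

Lemma monotone_shift w ws G : Defs.monotone G -> Defs.monotone (shift w ws G).
Proof.
move=> mG [s f] [t g] Gs Gt; have := mG _ _ Gs Gt; rewrite /dsub /=.
have -> : s + w - (t + w) = s - t by rewrite opprD addrACA subrr addr0.
lra.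
Qed.

(** The added terms expand the pairing, so at [t = 1] the gap [r - f x] is translation invariant. *)
Lemma mcone_shift w ws G x f t r : is_dual ws -> dual_graph G ->
  mcone (shift w ws G) x f t r ->
  mcone G (x + t *: w) (fun y => f y + t * ws y) t
    (r + f w + ws x + t * ws w).
Proof.
move=> dws dG; elim=> [|s {}f a {}x g {}t {}r Gs a0 _ ih].
  rewrite scale0r (dual0 dws) mul0r !addr0; have := mcone0 G; congr mcone.
  by apply/funext => y; rewrite mul0r addr0.
have df : is_dual f := dual_graph_shift dws dG Gs.
have Gs' : G (s + w, fun y => f y + ws y) := Gs.
have := mconeS Gs' a0 ih => /=.
have -> : a *: (s + w) + (x + t *: w) = a *: s + x + (a + t) *: w.
  by rewrite scalerDr scalerDl addrACA.
have -> : a * (f (s + w) + ws (s + w)) + (r + g w + ws x + t * ws w) =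
    a * f s + r + (a * f w + g w) + ws (a *: s + x) + (a + t) * ws w.
  by rewrite !(dualD df, dualD dws, dualZ dws); ring.
by congr mcone; apply/funext => y; ring.
Qed.

(** Condition (c) with epsilons in place of the extended real infimum. *)
Definition neg_inf G := forall ws wss, is_dual ws -> is_bidual wss ->
  forall e, 0 < e -> exists2 p, G p & dsub p.2 ws p.1 - wss (dsub p.2 ws) < e.

Lemma neg_inf_shift w ws G : is_dual ws -> dual_graph G -> neg_inf G ->
  neg_inf (shift w ws G).
Proof.
move=> dws dG nG vs vss dvs [lvss [C vssC]] e e0.
(* Translation by [w] adds the canonical image of [w] to the bidual element. *)
pose us f := vss f + f w.
have bus : is_bidual us.
  split=> [a f g df dg|]; first by rewrite /us lvss//; ring.
  exists (C + `|w|) => f df; rewrite (le_trans (ler_normD _ _))// mulrDl lerD//.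
    exact: vssC.
  by rewrite mulrC; exact: dnorm_ub.
have [[s f] Gs h] := nG _ _ (is_dual_add dvs dws) bus _ e0.
have df : is_dual f := dG _ Gs.
exists (s - w, dsub f ws).
  rewrite /shift /= subrK; move: Gs; congr (G (_, _)).
  by apply/funext => y; rewrite /dsub subrK.
move: h; rewrite /us /=.
have -> : dsub f (fun x => vs x + ws x) = dsub (dsub f ws) vs.
  by apply/funext => y; rewrite /dsub; ring.
have dd : is_dual (dsub (dsub f ws) vs) by do 2!apply: is_dual_dsub => //.
by rewrite (dualB dd); lra.
Qed.

End monotone_cone.

Lemma le_of_small (R : realType) (x y K : R) :
  (forall m, 0 < m -> x <= y + m * K) -> x <= y.
Proof.
move=> h; apply/ler_addgt0Pr => e e0.
have K0 : 0 < `|K| + 1 by rewrite ltr_wpDl.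
apply: (le_trans (h _ (divr_gt0 e0 K0))); rewrite lerD2l mulrAC ler_pdivrMr//.
by apply: (ler_wpM2l (ltW e0)); rewrite (le_trans (ler_norm _))// lerDl.
Qed.

(** Forms are rescaled to norm [rho], and a change of sign gives the lower bound. Homogeneity is
    asked on the dual only, where the functionals at hand are known to be linear. *)
Lemma dual_functional_bound (R : realType) (E : normedModType R) (F : (E -> R) -> R) (rho K : R) : 0 < rho ->
  (forall a (f : E -> R), is_dual f -> F (fun v => a * f v) = a * F f) ->
  (forall f, is_dual f -> dnorm f <= rho -> F f <= K) ->
  forall f, is_dual f -> `|F f| <= K / rho * dnorm f.
Proof.
move=> rho0 FZ FK.
have F0 : F (fun=> 0) = 0.
  rewrite -[RHS](mul0r (F (fun=> 0))) -(FZ _ _ (@is_dual0 R E)).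
  by congr F; apply/funext => v; rewrite mul0r.
have half f : is_dual f -> F f <= K / rho * dnorm f.
  move=> df; have := dnorm_ge0 f; rewrite le_eqVlt => /predU1P[f_0|fpos].
    rewrite -f_0 mulr0; suff -> : f = fun=> 0 by rewrite F0.
    apply/funext => v; apply/eqP; rewrite -normr_le0.
    by have := dnorm_ub v df; rewrite -f_0 mul0r.
  have a0 : 0 < rho / dnorm f by rewrite divr_gt0.
  have := FK (fun v => rho / dnorm f * f v) (is_dual_scale _ df).
  rewrite (FZ _ _ df) => le.
  have : F f <= (rho / dnorm f)^-1 * K.
    rewrite ler_pdivlMl//; apply: le; apply: dnorm_le_bound => [|v]; first exact: ltW.
    rewrite normrM gtr0_norm//; have := ler_wpM2l (ltW a0) (dnorm_ub v df).
    by rewrite [X in _ <= X -> _]mulrA divfK ?gt_eqF.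
  by rewrite invfM invrK mulrC mulrA.
move=> f df; rewrite ler_norml half// andbT lerNl.
have := half _ (is_dual_scale (-1) df); rewrite FZ// mulN1r => h.
apply: (le_trans h); apply: ler_wpM2l.
  rewrite divr_ge0 ?(ltW rho0)// -F0; apply: FK; first exact: is_dual0.
  by apply: dnorm_le_bound => [|v]; rewrite ?(ltW rho0)// normr0 mulr_ge0// ltW.
apply: dnorm_le_bound => [|v]; first exact: dnorm_ge0.
by rewrite mulN1r normrN; exact: dnorm_ub.
Qed.

(** * Duality between the convex hull and a convex penalty *)

Section duality.
Variables (R : realType) (E : normedModType R).
Variables (G : set (E * (E -> R))) (j : E -> R).
Hypothesis dG : dual_graph G.
Hypothesis nG : neg_inf G.

(* [conj_le phi k] says that the convex conjugate of [j] at [phi] is at most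
   [k]; the conjugate itself may be infinite. *)
Definition conj_le (phi : E -> R) (k : R) := forall y, phi y - j y <= k.

Hypothesis j_convex : forall x y t, 0 <= t <= 1 ->
  j (t *: x + (1 - t) *: y) <= t * j x + (1 - t) * j y.
Variable B : R.
Hypothesis j_bounded : forall x, `|x| <= 1 -> j x <= B.
Variables (s0 : E) (f0 : E -> R) (rho C eta : R).
Hypothesis Gs0 : G (s0, f0).
Hypothesis rho0 : 0 < rho.
(** Constraint qualification: a point of the range of [G] is interior to the domain of the
    conjugate. *)
Hypothesis conj_anchor : forall phi, is_dual phi ->
  dnorm (dsub phi f0) <= rho -> conj_le phi C.
Hypothesis eta0 : 0 < eta.

Let V : lmodType R := (E * (E -> R^o) * R^o)%type.
Let W : lmodType R := (V * R^o)%type.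

(** The cone over the epigraph of [k + j (- y) - eta], minus [mcone G] in the first three entries,
    with heights added. Over the origin the two parts match, so a negative height there means, after
    division by [m], a pair with total below [eta]. *)
Let P : set W := [set p | p = 0 \/ exists m y phi k z g t r,
  [/\ 0 < m, is_dual phi, conj_le phi k & mcone G z g t r] /\
  [/\ p.1.1.1 = m *: y - z, p.1.1.2 = (fun v => m * phi v - g v),
      p.1.2 = m - t & m * (k + j (- y) - eta) + r <= p.2]].

Let P_cone : convex_cone P.
Proof.
split; first by left.
- move=> p q [->|Pp]; first by rewrite add0r.
  move=> [->|Pq]; first by rewrite addr0; right.
  right; move: p q Pp Pq => [[[x f] t] a] [[[x' f'] t'] a'] /=.
  move=> [m [y [phi [k [z [g [u [r [[m0 dp cp K] [-> -> -> ha]]]]]]]]]].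
  move=> [n [y' [psi [l [z' [h [u' [r' [[n0 dq cq K'] [-> -> -> ha']]]]]]]]]].
  have mn : 0 < m + n by rewrite addr_gt0.
  pose c := m / (m + n).
  have c01 : 0 <= c <= 1.
    rewrite /c; apply/andP; split; first by apply: divr_ge0; exact: ltW.
    by rewrite ler_pdivrMr// mul1r lerDl ltW.
  have mc : (m + n) * c = m by rewrite /c mulrC divfK// gt_eqF.
  have nc : (m + n) * (1 - c) = n by rewrite mulrBr mc; ring.
  clearbody c.
  exists (m + n), (c *: y + (1 - c) *: y'), (fun v => c * phi v + (1 - c) * psi v),
    (c * k + (1 - c) * l), (z + z'), (fun v => g v + h v), (u + u'), (r + r').
  split; first split => //.
  + by apply: is_dual_comb => //; exact: is_dual_scale.
  + move=> v; have /andP[c0 c1] := c01.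
    have := ler_wpM2l c0 (cp v); have : 0 <= 1 - c by lra.
    by move=> /ler_wpM2l /(_ _ _ (cq v)); lra.
  + exact: mconeD.
  split.
  + by rewrite scalerDr !scalerA mc nc opprD addrACA.
  + apply/funext => v; rewrite -[LHS]/(m * phi v - g v + (n * psi v - h v)).
    by rewrite mulrDr !mulrA mc nc; ring.
  + by rewrite -[LHS]/(m - u + (n - u')); ring.
  + have := j_convex (- y) (- y') c01; rewrite !scalerN -opprD.
    move=> /(ler_wpM2l (ltW mn)); move: ha ha'; rewrite -[a + a']/(a + a' : R).
    set J := j _; set J1 := j (- y); set J2 := j (- y').
    rewrite !mulrDr !mulrA mc nc; lra.
- move=> b p b0 [->|]; first by left; rewrite scaler0.
  move: p => [[[x f] t] a] /=.
  move=> [m [y [phi [k [z [g [u [r [[m0 dp cp K] [-> -> -> ha]]]]]]]]]].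
  right; exists (b * m), y, phi, k, (b *: z), (fun v => b * g v), (b * u), (b * r).
  split; first by split => //; [rewrite mulr_gt0|apply: mconeZ => //; exact: ltW].
  split => /=.
  + by rewrite scalerBr scalerA.
  + by apply/funext => v; rewrite -mulrA -mulrBr.
  + by rewrite -mulrBr.
  + by rewrite -mulrA -mulrDr; apply: ler_wpM2l => //; exact: ltW.
Qed.

(** Write [(x, f, t)] as [m] times a point minus [u] times the anchor, where [m = t + u]. Then
    [phi - f0] is [g] divided by [m], which enters the [rho]-ball once [m >= dnorm g / rho]. *)
Let P_domain x f t : is_dual f -> exists a, P ((x, f, t), a).
Proof.
move=> df; have df0 : is_dual f0 := dG Gs0.
pose g v := f v - t * f0 v.
have dg : is_dual g by exact: is_dual_dsub df (is_dual_scale _ df0).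
have g0 : 0 <= dnorm g / rho by rewrite divr_ge0 ?dnorm_ge0// ltW.
pose u := `|t| + 1 + dnorm g / rho.
have u0 : 0 <= u by rewrite /u !addr_ge0.
pose m := t + u.
have m_ge : 1 + dnorm g / rho <= m.
  by have := ler_norm (- t); rewrite normrN /m /u; lra.
have m0 : 0 < m by lra.
have mK : m != 0 by rewrite gt_eqF.
have mE : m = t + u by []; clearbody m.
pose phi v := m^-1 * (f v + u * f0 v).
have dphi : is_dual phi.
  by apply: is_dual_scale; apply: is_dual_add => //; exact: is_dual_scale.
exists (m * (C + j (- (m^-1 *: (x + u *: s0))) - eta) + u * f0 s0); right.
exists m, (m^-1 *: (x + u *: s0)), phi, C, (u *: s0), (fun v => u * f0 v), u, (u * f0 s0).
split; first split => //.
- apply: conj_anchor => //; apply: dnorm_le_bound => [|v]; first exact: ltW.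
  have -> : dsub phi f0 v = m^-1 * g v.
    rewrite /dsub /phi /g -[f0 v in X in _ - X](mulKf mK) -mulrBr.
    by congr (_ * _); rewrite mE; ring.
  rewrite normrM gtr0_norm ?invr_gt0// mulrC ler_pdivrMr//.
  apply: (le_trans (dnorm_ub v dg)); rewrite mulrAC; apply: ler_wpM2r => //.
  by rewrite mulrC -ler_pdivrMr//; lra.
- have := mconeZ u0 (mcone_gen Gs0).
  by rewrite mulr1.
split => //=.
- by rewrite scalerA divff// scale1r addrK.
- by apply/funext => v; rewrite /phi mulVKf// addrK.
- by rewrite mE addrK.
Qed.

(** Otherwise separation gives [L (x, f, t) = L1 x + L2 f + t * c]. Condition (c) at [ws = - L1] and
    [- L2] yields [L2 L1 <= c]; then [upper] at [ws] lowers any bound on the conjugate of [j] at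
    [ws] by [eta], again and again, although this conjugate is at least [- j 0]. *)
Lemma conjugate_duality : exists x phi r k,
  [/\ mcone G x phi 1 r, conj_le phi k & r + k + j (- x) <= eta].
Proof.
apply: contrapT => far.
have [] := @cone_separation R V P P_cone.
- move=> a [e|]; first by have -> : a = 0 := congr1 snd e.
  move=> [m [y [phi [k [z [g [u [r [[m0 dp cp K] [/= e1 e2 e3 ha]]]]]]]]]].
  have {}e1 : z = m *: y by apply/esym/eqP; rewrite -subr_eq0; apply/eqP/esym.
  have {}e3 : u = m by apply/esym/eqP; rewrite -subr_eq0; apply/eqP/esym.
  have {}e2 : g = fun v => m * phi v.
    apply/funext => v; apply/esym/eqP; rewrite -subr_eq0.
    by apply/eqP/esym; exact: (f_equal (fun h : E -> R^o => h v) e2).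
  have mV : 0 <= m^-1 by rewrite invr_ge0 ltW.
  have mK : m != 0 by rewrite gt_eqF.
  have := mconeZ mV K.
  rewrite e1 e2 e3 scalerA mulVf// scale1r.
  have -> : (fun v => m^-1 * (m * phi v)) = phi by apply/funext => v; rewrite mulKf.
  move=> K1; apply: le_trans ha.
  have : eta < m^-1 * r + k + j (- y).
    by rewrite ltNge; apply/negP => le; apply: far; exists y, phi, (m^-1 * r), k.
  rewrite -(ltr_pM2l m0) !mulrDr mulVKf// => h.
  by rewrite mulrN; lra.
- move=> [[[x f] t] a] Pp /=.
  have df : is_dual f.
    case: Pp => [e|].
      by have -> : f = 0 := congr1 (fun p : W => p.1.1.2) e; exact: is_dual0.
    move=> [m [y [phi [k [z [g [u [r [[m0 dp cp K] /= [_ -> _ _]]]]]]]]]].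
    by apply: is_dual_dsub; [exact: is_dual_scale|exact: mcone_dual dG K].
  have dN : is_dual (fun v => - f v).
    suff -> : (fun v => - f v) = fun v => -1 * f v by exact: is_dual_scale.
    by apply/funext => v; rewrite mulN1r.
  exact: (@P_domain (- x) _ (- t) dN).
move=> L [LP Llin].
have LD (a : R) (p q : V) : is_dual p.1.2 -> is_dual q.1.2 ->
    L (a *: p + q) = a * L p + L q.
  move: p q => [[x f] t] [[x' f'] t'] /= /(P_domain x t)[b Pb].
  by move=> /(P_domain x' t')[b' Pb']; exact: Llin Pb Pb'.
have d0 : @is_dual R E 0 by exact: is_dual0.
pose L1 x := L (x, 0, 0); pose L2 (f : E -> R) := L (0, f, 0); pose c := L (0, 0, 1).
have L1lin (a : R) x y : L1 (a *: x + y) = a * L1 x + L1 y.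
  rewrite /L1 -LD//; congr (L (_, _, _)) => /=.
    by rewrite scaler0 addr0.
  by rewrite scaler0 addr0.
have L2lin (a : R) f g : is_dual f -> is_dual g ->
    L2 (fun v => a * f v + g v) = a * L2 f + L2 g.
  move=> df dg; rewrite /L2 -LD//; congr (L (_, _, _)) => /=.
    by rewrite scaler0 addr0.
  by rewrite scaler0 addr0.
have LE x f (t : R) : is_dual f -> L (x, f, t) = L1 x + L2 f + t * c.
  move=> df.
  have -> : ((x, f, t) : V) = t *: ((0, 0, 1) : V) + (1 *: ((x, 0, 0) : V) + (0, f, 0)).
    congr (_, _, _) => /=.
    - by rewrite scaler0 add0r scale1r addr0.
    - by rewrite scaler0 add0r scaler0 add0r.
    - by rewrite scaler0 addr0 addr0 -[t *: 1]/(t * 1) mulr1.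
  rewrite LD//; last exact: (is_dual_comb 1 d0 df).
  by rewrite LD// mul1r -/c -/(L1 x) -/(L2 f); ring.
have df0 : is_dual f0 := dG Gs0.
have upper y phi k : is_dual phi -> conj_le phi k ->
    L1 y + L2 phi + c <= k + j (- y) - eta.
  move=> dphi cphi; rewrite -[c]mul1r -LE//; apply: (LP (_, _)); right.
  exists 1, y, phi, k, 0, (fun=> 0), 0, 0; split; first by split=> //; exact: mcone0.
  split=> /=; first by rewrite scale1r subr0.
  - by apply/funext => v; rewrite mul1r subr0.
  - by rewrite subr0.
  - by rewrite mul1r addr0.
have lower s f : G (s, f) -> - (L1 s + L2 f + c) <= f s.
  move=> Gs; have df : is_dual f := dG Gs.
  pose h m v := m * f0 v - f v.
  (* Nonzero elements of [P] have [m > 0], so the generator is perturbed by [m] times the anchor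
     form and [m] tends to [0]. *)
  apply: (@le_of_small _ _ _ (C + j (- 0) - eta - L2 f0 - c)) => m m0.
  have dh : is_dual (h m) by exact: is_dual_dsub (is_dual_scale _ df0) df.
  have : L (- s, h m, m - 1) <= m * (C + j (- 0) - eta) + f s.
    apply: (LP (_, _)); right.
    exists m, 0, f0, C, s, f, 1, (f s); split.
      split=> //; last exact: mcone_gen.
      by apply: conj_anchor => //; apply: dnorm_le_bound => [|v]; rewrite ?(ltW rho0)// /dsub subrr normr0 mulr_ge0// ltW.
    by split=> //=; rewrite scaler0 sub0r.
  rewrite LE//.
  have -> : L1 (- s) = - L1 s.
    have := L1lin (-1) s 0; rewrite scaleN1r addr0 => ->.
    have := L1lin 1 0 0; rewrite scaler0 addr0; lra.
  have -> : L2 (h m) = m * L2 f0 - L2 f.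
    have e : h m = fun v => -1 * f v + (m * f0 v + (0 : E -> R) v).
      by apply/funext => v; rewrite /h /= addr0; ring.
    have L20 : L2 0 = 0.
      have := L2lin 1 _ _ d0 d0; rewrite mul1r.
      have -> : (fun v => 1 * (0 : E -> R) v + (0 : E -> R) v) = 0.
        by apply/funext => v; rewrite mul1r addr0.
      lra.
    by rewrite e !L2lin//; [rewrite L20; ring|exact: is_dual_comb].
  lra.
have L10 : L1 0 = 0 by have := L1lin 1 0 0; rewrite scaler0 addr0; lra.
have L20 : L2 (fun=> 0) = 0.
  have := L2lin 1 _ _ d0 d0.
  have -> : (fun v => 1 * (0 : E -> R) v + (0 : E -> R) v) = fun=> 0.
    by apply/funext => v; rewrite mul1r addr0.
  by rewrite mul1r -[L2 0]/(L2 (fun=> 0)); lra.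
have L2Z (a : R) f : is_dual f -> L2 (fun v => a * f v) = a * L2 f.
  move=> df; rewrite -[RHS]addr0 -L20 -(L2lin _ _ _ df d0).
  by congr L2; apply/funext => v; rewrite addr0.
have conj0 : conj_le f0 C.
  by apply: conj_anchor => //; apply: dnorm_le_bound => [|v]; rewrite ?(ltW rho0)// /dsub subrr normr0 mulr_ge0// ltW.
(* Continuity of [L1] comes from the bound on [j] over the unit ball, that of [L2] below from the
   [rho]-ball around [f0]. *)
have dL1 : is_dual L1.
  apply: (@is_dual_bounded _ _ _ (C + B - eta - L2 f0 - c)) => //.
  apply: linear_form_bound => // x x1.
  have := upper x _ _ df0 conj0.
  have := @j_bounded (- x); rewrite normrN => /(_ x1).
  lra.
pose ws x := - L1 x.
have dws : is_dual ws.
  suff -> : ws = fun v => -1 * L1 v by exact: is_dual_scale.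
  by apply/funext => v; rewrite mulN1r.
have L2ws : L2 ws = - L2 L1.
  by rewrite -mulN1r -L2Z//; congr L2; apply/funext => v; rewrite mulN1r.
have bL2 : is_bidual (fun f => - L2 f).
  split=> [a f g df dg|]; first by rewrite L2lin//; ring.
  pose K := C + j (- 0) - eta - L2 f0 - c.
  have small f : is_dual f -> dnorm f <= rho -> L2 f <= K.
    move=> df fr.
    have dff : is_dual (fun v => 1 * f v + f0 v) by exact: is_dual_comb.
    have : conj_le (fun v => 1 * f v + f0 v) C.
      apply: conj_anchor => //; suff -> : dsub (fun v => 1 * f v + f0 v) f0 = f by [].
      by apply/funext => v; rewrite /dsub mul1r addrK.
    move=> /(upper 0 _ _ dff); rewrite L2lin// L10 /K; lra.
  exists (K / rho) => f df; rewrite normrN.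
  exact: (dual_functional_bound rho0 L2Z small).
have L2L1 : L2 L1 <= c.
  rewrite leNgt -subr_gt0; apply/negP => pos.
  have [[s f] Gs /=] := nG dws bL2 pos.
  have df : is_dual f := dG Gs.
  have -> : dsub f ws = fun v => 1 * L1 v + f v.
    by apply/funext => v; rewrite /dsub /ws; ring.
  by rewrite L2lin//; have := lower _ _ Gs; lra.
pose k0 := C - eta - L2 f0 - c.
have conj_ws n : conj_le ws (k0 - n%:R * eta).
  elim: n => [|n ih] y.
    by have := upper (- y) _ _ df0 conj0; rewrite (dualN dL1) opprK /ws /k0; lra.
  have := upper (- y) _ _ dws ih; rewrite (dualN dL1) opprK L2ws -natr1 /ws.
  lra.
have := conj_ws (Num.bound `|(k0 + j 0) / eta|) 0.
rewrite /ws L10 oppr0 sub0r.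
have := archi_boundP (normr_ge0 ((k0 + j 0) / eta)).
set n := _%:R => hn; have : (k0 + j 0) / eta < n by exact: le_lt_trans (ler_norm _) hn.
by rewrite ltr_pdivrMr//; lra.
Qed.

End duality.

(** * Quadratic penalty and approximation by points of the graph *)

Section brondsted_rockafellar.
Variables (R : realType) (E : normedModType R).
Implicit Types (G : set (E * (E -> R))) (x y w : E) (f g h ws : E -> R).

Lemma ereal_inf_le0P (T : Type) (A : set T) (F : T -> R) :
  (ereal_inf [set (F s)%:E | s in A] <= 0)%E <->
  forall e, 0 < e -> exists2 s, A s & F s < e.
Proof.
split=> [le0 e e0|h].
  apply: contrapT => no.
  suff : (e%:E <= 0)%E by rewrite lee_fin leNgt e0.
  apply: le_trans le0; apply: le_ereal_inf_tmp => _ [s As <-].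
  by rewrite lee_fin leNgt; apply/negP => Fs; apply: no; exists s.
apply/lee_addgt0Pr => e /h[s As Fs]; rewrite add0e.
apply: (@le_trans _ _ (F s)%:E); first by apply: ereal_inf_lbound; exists s.
by rewrite lee_fin ltW.
Qed.

Lemma dnorm_dsubC f g : dnorm (dsub f g) = dnorm (dsub g f).
Proof.
rewrite /dnorm; congr (sup _); apply/seteqP.
by split=> _ [x x1 <-]; exists x => //; rewrite /dsub distrC.
Qed.

Lemma dnorm_triangle f g h : is_dual f -> is_dual g -> is_dual h ->
  dnorm (dsub f h) <= dnorm (dsub f g) + dnorm (dsub g h).
Proof.
move=> df dg dh; apply: dnorm_le_bound => [|x].
  by rewrite addr_ge0// dnorm_ge0.
have -> : dsub f h x = dsub f g x + dsub g h x by rewrite /dsub; ring.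
rewrite (le_trans (ler_normD _ _))// mulrDl.
by apply: lerD; apply: dnorm_ub; exact: is_dual_dsub.
Qed.

Lemma dual_ge f x : is_dual f -> - (dnorm f * `|x|) <= f x.
Proof. by move=> /(dnorm_ub x); rewrite ler_norml => /andP[]. Qed.

Lemma dual_le f x : is_dual f -> f x <= dnorm f * `|x|.
Proof. by move=> /(dnorm_ub x); rewrite ler_norml => /andP[]. Qed.

Lemma maximally_monotone_mem G w ws : maximally_monotone G -> is_dual ws ->
  (forall p, G p -> 0 <= dsub p.2 ws (p.1 - w)) -> G (w, ws).
Proof.
move=> [[dG G0] [mG maxG]] dws pos.
have <- : G `|` [set (w, ws)] = G; last by right.
have dsym p : G p -> 0 <= dsub ws p.2 (w - p.1).
  move=> Gp; have := pos _ Gp; have dp := dG _ Gp.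
  by rewrite /dsub !(dualB dp, dualB dws); lra.
apply: maxG => [|p q|p]; last by left.
  by split=> [p [/dG//|->//]|]; have [p Gp] := G0; exists p; left.
move=> [Gp|->] [Gq|->] /=; [exact: mG|exact: pos|exact: dsym|].
by rewrite /dsub subrr.
Qed.

Definition half_sqr x : R := 1 / 2 * `|x| ^+ 2.

Lemma half_sqr_convex x y t : 0 <= t <= 1 ->
  half_sqr (t *: x + (1 - t) *: y) <= t * half_sqr x + (1 - t) * half_sqr y.
Proof.
move=> /andP[t0 t1]; rewrite /half_sqr.
have : `|t *: x + (1 - t) *: y| <= t * `|x| + (1 - t) * `|y|.
  rewrite (le_trans (ler_normD _ _))// !normrZ !ger0_norm//; lra.
have := normr_ge0 (t *: x + (1 - t) *: y).
move: (`|_ + _|) (`|x|) (`|y|) => n a b n0 nab.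
have : n ^+ 2 <= (t * a + (1 - t) * b) ^+ 2 by rewrite lerXn2r ?nnegrE//; lra.
have : 0 <= t * (1 - t) * (a - b) ^+ 2.
  by rewrite mulr_ge0 ?sqr_ge0// mulr_ge0//; lra.
nra.
Qed.

(** Test at [dnorm f *: x] with [x] nearly norming for [f]. *)
Lemma conj_le_half_sqr f k : is_dual f -> conj_le half_sqr f k ->
  1 / 2 * dnorm f ^+ 2 <= k.
Proof.
move=> df fk; apply: (@le_of_small _ _ _ (dnorm f)) => e e0.
have [x x1 fx] := dnorm_approx df e0.
have := fk (dnorm f *: x); rewrite (dualZ df) /half_sqr normrZ ger0_norm ?dnorm_ge0//.
have := dnorm_ge0 f; move: (dnorm f) (f x) fx => d a ad d0.
have : (d * `|x|) ^+ 2 <= d ^+ 2.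
  by rewrite lerXn2r ?nnegrE ?mulr_ge0// ler_piMr.
have := ler_wpM2l d0 (ltW ad).
lra.
Qed.

Lemma conj_le_half_sqr_ball f g : is_dual f -> is_dual g ->
  dnorm (dsub f g) <= 1 -> conj_le half_sqr f (1 / 2 * (dnorm g + 1) ^+ 2).
Proof.
move=> df dg fg y; rewrite /half_sqr.
have : f y <= (dnorm g + 1) * `|y|.
  have -> : f y = g y + dsub f g y by rewrite /dsub; ring.
  rewrite mulrDl lerD ?dual_le// (le_trans (dual_le _ (is_dual_dsub df dg)))//.
  by rewrite ler_wpM2r.
have := sqr_ge0 (dnorm g + 1 - `|y|).
nra.
Qed.

Variable G : set (E * (E -> R)).
Hypothesis dG : dual_graph G.
Hypothesis mG : Defs.monotone G.
Hypothesis nG : neg_inf G.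
Hypothesis G0 : exists p, G p.

(** Duality for [half_sqr] with [(w, ws)] moved to the origin. The total splits into the gap and the
    quasidensity expression; both are nonnegative, so each is at most [e]. *)
Lemma mcone_dense w ws e : is_dual ws -> 0 < e ->
  exists x f r, [/\ mcone G x f 1 r, r - f x <= e &
    1 / 2 * `|x - w| ^+ 2 + 1 / 2 * dnorm (dsub f ws) ^+ 2
      + dsub f ws (x - w) <= e].
Proof.
move=> dws e0; have [[s0 f0] Gs0] := G0.
have df0 : is_dual f0 := dG Gs0.
pose G' := shift w ws G.
have dG' : dual_graph G' by exact: dual_graph_shift.
have mG' : Defs.monotone G' by exact: monotone_shift.
have Gs0' : G' (s0 - w, dsub f0 ws).
  rewrite /G' /shift /= subrK; move: Gs0; congr (G (_, _)).
  by apply/funext => y; rewrite /dsub subrK.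
have nG' : neg_inf G' by exact: neg_inf_shift.
have bounded x : `|x| <= 1 -> half_sqr x <= 1 / 2.
  by move=> x1; rewrite /half_sqr ler_piMr// expr_le1.
have anchor phi : is_dual phi -> dnorm (dsub phi (dsub f0 ws)) <= 1 ->
    conj_le half_sqr phi (1 / 2 * (dnorm (dsub f0 ws) + 1) ^+ 2).
  by move=> dphi; apply: conj_le_half_sqr_ball => //; exact: dG' Gs0'.
have [y [phi [r [k [K ck le]]]]] := conjugate_duality dG' nG'
  half_sqr_convex bounded Gs0' ltr01 anchor e0.
have dphi : is_dual phi := mcone_dual dG' K.
have := conj_le_half_sqr dphi ck => kphi.
exists (y + w), (fun v => phi v + ws v), (r + phi w + ws y + ws w).
have -> : dsub (fun v => phi v + ws v) ws = phi.
  by apply/funext => v; rewrite /dsub addrK.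
rewrite addrK (dualD dphi) (dualD dws).
have := mcone_monotone dG' mG' K K; rewrite mulr1 => rphi.
move: le; rewrite /half_sqr normrN => le; split.
- have := mcone_shift dws dG K; rewrite scale1r mul1r.
  by congr mcone; apply/funext => v; rewrite mul1r.
- have := dual_ge y dphi; have := sqr_ge0 (`|y| - dnorm phi); nra.
- lra.
Qed.

Lemma mcone_gap x f r x' f' r' : mcone G x f 1 r -> mcone G x' f' 1 r' ->
  - dsub f f' (x - x') <= (r - f x) + (r' - f' x').
Proof.
move=> K K'; have := mcone_monotone dG mG K K'.
have df := mcone_dual dG K; have df' := mcone_dual dG K'.
by rewrite /dsub (dualB df) (dualB df'); lra.
Qed.

End brondsted_rockafellar.

(** Iterate [mcone_dense] at the current point, halving the root of the gap each time. The steps sum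
    to at most [4 * a], and since the gaps vanish the limit is monotonically related to [G]. *)
Lemma brondsted_rockafellar (R : realType) (E : completeNormedModType R)
    (G : set (E * (E -> R))) x f r a :
  maximally_monotone G -> neg_inf G -> mcone G x f 1 r -> 0 < a ->
  r - f x <= a ^+ 2 ->
  exists s g, [/\ G (s, g), `|s - x| <= 4 * a & dnorm (dsub g f) <= 4 * a].
Proof.
move=> maxG nG K a0 gap; have [[dG G0] [mG _]] := maxG.
pose T : Type := (E * (E -> R) * R)%type.
pose good n (p : T) := mcone G p.1.1 p.1.2 1 p.2 /\
  p.2 - p.1.2 p.1.1 <= (a / 2 ^+ n) ^+ 2.
pose near n (p q : T) := `|q.1.1 - p.1.1| <= 2 * a / 2 ^+ n /\
  dnorm (dsub q.1.2 p.1.2) <= 2 * a / 2 ^+ n.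
have /choice[F FP] (np : nat * T) : exists q : T,
    good np.1 np.2 -> good np.1.+1 q /\ near np.1 np.2 q.
  move: np => [n [[y g] b]] /=.
  (* Choice needs a value everywhere: a bad input is returned unchanged. *)
  have [[/= Ky gapy]|ng] := pselect (good n (y, g, b)); last by exists (y, g, b).
  set c := a / 2 ^+ n in gapy.
  have c0 : 0 < c by rewrite divr_gt0// exprn_gt0.
  have dg := mcone_dual dG Ky.
  have [|z [h [d [Kz gapz le]]]] := @mcone_dense _ _ _ dG mG nG G0 y _ ((c / 2) ^+ 2) dg.
    by rewrite exprn_gt0// divr_gt0.
  have mon := mcone_gap dG mG Kz Ky.
  exists (z, h, d) => _; rewrite /good /near /= -mulrA -/c.
  have -> : a / 2 ^+ n.+1 = c / 2 by rewrite /c exprS invfM; ring.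
  have D0 := dnorm_ge0 (dsub h g); have N0 := normr_ge0 (z - y).
  (* Adding [le], [mon] and the two gaps bounds the sum of the squared distances by [3 * c ^+ 2], so
     each distance is at most [2 * c]. *)
  split=> //; split.
  - by rewrite leNgt; apply/negP => lt; have := sqr_ge0 (dnorm (dsub h g)); nra.
  - by rewrite leNgt; apply/negP => lt; have := sqr_ge0 `|z - y|; nra.
pose u := fix u n : T := if n is m.+1 then F (m, u m) else (x, f, r).
have u_good n : good n (u n).
  elim: n => [|n ih]; last by have [] := FP (n, u n) ih.
  by split=> //=; rewrite expr0 divr1.
have u_near n : near n (u n) (u n.+1) by have [] := FP (n, u n) (u_good n).
have du n : is_dual (u n).1.2 by have [/(mcone_dual dG)] := u_good n.
have [l lu] := geometric_limit (fun n => (u_near n).1).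
have [lf dlf lfu] := dual_geometric_limit du (fun n => (u_near n).2).
exists l, lf; split; last 2 first.
- by have := lu 0%N; rewrite expr0 divr1 mulrA -natrM.
- by have := lfu 0%N; rewrite expr0 divr1 mulrA -natrM.
apply: maximally_monotone_mem => // -[s g] Gs /=.
have dg : is_dual g := dG _ Gs.
rewrite -oppr_le0.
apply: (@le0_half_pow _ _ (a ^+ 2 + 4 * a * `|l - s| +
  (dnorm (dsub lf g) + 4 * a) * (4 * a))) => n.
have [Kn gapn] := u_good n.
have := mcone_gap dG mG Kn (mcone_gen Gs).
rewrite subrr addr0 => /le_trans/(_ gapn) mon.
(* The first term is at least minus the gap of [u n]; the others are of order [1 / 2 ^+ n]. *)
have -> : dsub g lf (s - l) = dsub (u n).1.2 g ((u n).1.1 - s)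
    + dsub lf (u n).1.2 (l - s) + dsub (u n).1.2 g (l - (u n).1.1).
  have dn := du n.
  by rewrite /dsub !(dualB dg, dualB dlf, dualB dn); ring.
have p1 : (1 : R) <= 2 ^+ n by rewrite exprn_ege1// ler1n.
have p0 : 0 < (2 : R) ^+ n by lra.
have b1 := dual_ge (l - s) (is_dual_dsub dlf (du n)).
have b2 := dual_ge (l - (u n).1.1) (is_dual_dsub (du n) dg).
have tri := dnorm_triangle (du n) dlf dg.
rewrite (dnorm_dsubC _ lf) in tri.
have pinv : 0 < ((2 : R) ^+ n)^-1 <= 1 by rewrite invr_gt0 p0 invf_le1.
have := lfu n; have := lu n.
have -> : 2 * (2 * a) / 2 ^+ n = 4 * a / 2 ^+ n by rewrite mulrA -natrM.
have e1 : (a / 2 ^+ n) ^+ 2 <= a ^+ 2 / 2 ^+ n.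
  rewrite exprMn ler_wpM2l ?sqr_ge0// expr2 ler_piMr ?invr_ge0 ?(ltW p0)//.
  by case/andP: pinv.
move: pinv mon e1; move: (_^-1) => p /andP[{}p0 {}p1] mon e1 le1 le2.
have e2 : 4 * a * p <= 4 * a by rewrite ler_piMr// mulr_ge0// ltW.
have c1 := ler_wpM2r (normr_ge0 (l - s)) le2.
have c2 : dnorm (dsub (u n).1.2 g) * `|l - (u n).1.1| <=
    (dnorm (dsub lf g) + 4 * a) * (4 * a * p).
  by apply: ler_pM => //; [exact: dnorm_ge0|lra].
lra.
Qed.

(** * From quasidensity and from type (FP) to condition (c) *)

Section equivalences.
Variables (R : realType) (E : normedModType R).
Implicit Types (f g ws : E -> R).

Lemma bidualZ (wss : (E -> R) -> R) a f : is_bidual wss -> is_dual f ->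
  wss (fun v => a * f v) = a * wss f.
Proof.
move=> [lw _] df; have d0 := @is_dual0 R E.
have w0 : wss (fun=> 0) = 0.
  have := lw 1 _ _ d0 d0.
  have -> : (fun x : E => 1 * 0 + 0) = (fun=> 0 : R).
    by apply/funext => v; rewrite mulr0 addr0.
  lra.
rewrite -[RHS]addr0 -w0 -lw//; congr wss.
by apply/funext => v; rewrite addr0.
Qed.

Lemma bidualD (wss : (E -> R) -> R) f g : is_bidual wss -> is_dual f ->
  is_dual g -> wss (fun v => f v + g v) = wss f + wss g.
Proof.
move=> [lw _] df dg; rewrite -[wss f]mul1r -lw//; congr wss.
by apply/funext => v; rewrite mul1r.
Qed.

(* The element [d] is an approximate duality map of [wss]. *)
Lemma bidual_duality_map (wss : (E -> R) -> R) e : is_bidual wss -> 0 < e ->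
  exists d N, [/\ is_dual d, dnorm d <= N,
    forall f, is_dual f -> `|wss f| <= N * dnorm f & N ^+ 2 - e <= wss d].
Proof.
move=> bw e0; pose A := [set wss f | f in [set f | is_dual f /\ dnorm f <= 1]].
have d0 := @is_dual0 R E.
have n0 : dnorm (fun _ : E => 0 : R) <= 1.
  by apply: dnorm_le_bound => // v; rewrite normr0 mul1r.
have w0 : wss (fun=> 0) = 0.
  rewrite -[RHS](mul0r (wss (fun=> 0))) -bidualZ//; congr wss.
  by apply/funext => v; rewrite mul0r.
have [_ [C wC]] := bw.
have hA : has_sup A.
  split; first by exists (wss (fun=> 0)), (fun=> 0).
  exists `|C| => _ [f [df f1] <-]; rewrite (le_trans (ler_norm _))//.
  rewrite (le_trans (wC _ df))// (le_trans (ler_wpM2r (dnorm_ge0 f) (ler_norm C)))//.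
  by rewrite ler_piMr.
pose N := sup A.
have wN f : is_dual f -> `|wss f| <= N * dnorm f.
  move=> df; rewrite -[N]divr1; apply: dual_functional_bound => // [a g dg|g dg g1].
    exact: bidualZ.
  by apply: ub_le_sup; [case: hA|exists g].
have N0 : 0 <= N by rewrite -w0; apply: ub_le_sup; [case: hA|exists (fun=> 0)].
(* [N] may vanish, hence the tolerance [e / (N + 1)]. *)
have N1 : 0 < N + 1 by lra.
have [_ [f [df f1] <-] fN] := sup_adherent (divr_gt0 e0 N1) hA.
exists (fun v => N * f v), N; split => //.
- exact: is_dual_scale.
- apply: dnorm_le_bound => // v; rewrite normrM ger0_norm//; apply: ler_wpM2l => //.
  by rewrite (le_trans (dnorm_ub v df))// ler_piMl.
- rewrite bidualZ//; have := ler_wpM2l N0 (ltW fN); rewrite -/N mulrBr -expr2.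
  move=> h; apply: le_trans h; rewrite lerD2l lerN2 mulrCA ler_piMr ?(ltW e0)//.
  by rewrite ler_pdivrMr// mul1r lerDl.
Qed.

Lemma cond_c_neg_inf (G : set (E * (E -> R))) : cond_c G <-> neg_inf G.
Proof.
split=> [cG ws wss dws bw|nG ws wss dws bw].
  by have /ereal_inf_le0P := cG ws wss dws bw.
by apply/ereal_inf_le0P => e e0; exact: nG.
Qed.

Lemma quasidense_neg_inf (G : set (E * (E -> R))) : dual_graph G ->
  quasidense G -> neg_inf G.
Proof.
move=> dG qG ws wss dws bw e e0.
have e2 : 0 < e / 2 by lra.
have [d [N [dd dN wN Nd]]] := bidual_duality_map bw e2.
have dx := is_dual_add dws dd.
have /ereal_inf_le0P/(_ _ e2)[[s f] Gs /=] := qG 0 _ dx.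
have df : is_dual f := dG _ Gs.
rewrite subr0; set h := dsub f _ => le.
have dh : is_dual h by exact: is_dual_dsub.
exists (s, f) => //=.
have -> : dsub f ws = fun v => h v + d v.
  by apply/funext => v; rewrite /h /dsub; ring.
rewrite bidualD//.
have := wN _ dh; rewrite ler_norml => /andP[whN _].
have := dual_le s dd.
have N0 : 0 <= N by rewrite (le_trans _ dN)// dnorm_ge0.
have := ler_wpM2r (normr_ge0 s) dN.
(* The two halves of [N ^+ 2] in [wss d] absorb [N * |s|] and [N * dnorm h], leaving the
   quasidensity expression plus [e / 2]. *)
have := sqr_ge0 (N - dnorm h); have := sqr_ge0 (N - `|s|).
nra.
Qed.

Lemma dnorm_comb f g a b : is_dual f -> is_dual g ->
  dnorm (fun v => a * f v + b * g v) <= `|a| * dnorm f + `|b| * dnorm g.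
Proof.
move=> df dg; apply: dnorm_le_bound => [|v].
  by rewrite addr_ge0// mulr_ge0// dnorm_ge0.
rewrite (le_trans (ler_normD _ _))// !normrM mulrDl -!mulrA.
by apply: lerD; apply: ler_wpM2l => //; exact: dnorm_ub.
Qed.

(** If (c) fails by [e], then on the tube [f - ws] is [l * g] plus a small rest, and [g w = wss g]
    lets evaluation at [w] replace [wss] up to less than [e]. Type (FP) then puts [(w, ws)] in [G],
    where the expression in (c) is [0]. *)
Lemma type_FP_neg_inf (G : set (E * (E -> R))) : dual_graph G ->
  (exists p, G p) -> type_FP G -> neg_inf G.
Proof.
move=> dG [[t1 t2] Gt] fp ws wss dws bw e e0; apply: contrapT => no.
have {}no p : G p -> e <= dsub p.2 ws p.1 - wss (dsub p.2 ws).
  by move=> Gp; rewrite leNgt; apply/negP => lt; apply: no; exists p.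
have dt : is_dual t2 := dG _ Gt.
pose g := dsub t2 ws; have dg : is_dual g by exact: is_dual_dsub.
have w0 : wss (fun=> 0) = 0.
  rewrite -[RHS](mul0r (wss g)) -bidualZ//; congr wss.
  by apply/funext => v; rewrite mul0r.
(* If [g] vanishes identically then so does [wss g], and [w = 0] serves. *)
have [w gw] : exists w, g w = wss g.
  have [[x gx]|gno] := pselect (exists x, g x != 0).
    by exists ((wss g / g x) *: x); rewrite (dualZ dg) divfK.
  exists 0; rewrite (dual0 dg); suff -> : g = fun=> 0 by rewrite w0.
  apply/funext => x; apply/eqP; apply: contrapT => /negP gx.
  by apply: gno; exists x.
have [_ [C wC]] := bw.
(* A rest of norm below [d] changes [wss] and evaluation at [w] by less than [e] in total. *)
pose d := e / (`|C| + `|w| + 1).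
have c0 : 0 < `|C| + `|w| + 1 by rewrite ltr_wpDl// addr_ge0.
have d0 : 0 < d by rewrite divr_gt0.
pose res f l := fun v => f v - ws v - l * g v.
have dres f l : is_dual f -> is_dual (res f l).
  by move=> df; exact: is_dual_dsub (is_dual_dsub df dws) (is_dual_scale _ dg).
pose U := [set f | is_dual f /\ exists2 l, 0 <= l <= 1 & dnorm (res f l) < d].
have dz f : (forall v, f v = 0) -> dnorm f < d.
  move=> f0; apply: le_lt_trans d0; apply: dnorm_le_bound => // v.
  by rewrite f0 normr0 mul0r.
suff Gw : G (w, ws).
  have := no _ Gw; rewrite /=; have -> : dsub ws ws = fun=> 0.
    by apply/funext => v; rewrite /dsub subrr.
  by rewrite w0 subrr; lra.
apply: (fp U).
- by move=> f [].
- move=> f [df [l l01 lt]]; exists (d - dnorm (res f l)); first by rewrite subr_gt0.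
  move=> h dh hf; split=> //; exists l => //.
  have -> : res h l = fun v => 1 * dsub h f v + 1 * res f l v.
    by apply/funext => v; rewrite /dsub /res; ring.
  apply: le_lt_trans (dnorm_comb _ _ (is_dual_dsub dh df) (dres _ l df)) _.
  by rewrite normr1 !mul1r; lra.
- move=> f h t [df [l /andP[l0 l1] lt]] [dh [m /andP[m0 m1] mt]] /andP[t_ge0 t_le1].
  split; first by apply: is_dual_comb => //; exact: is_dual_scale.
  exists (t * l + (1 - t) * m); first by apply/andP; split; nra.
  have -> : res (fun v => t * f v + (1 - t) * h v) (t * l + (1 - t) * m) =
      fun v => t * res f l v + (1 - t) * res h m v.
    by apply/funext => v; rewrite /res; ring.
  apply: le_lt_trans (dnorm_comb _ _ (dres _ l df) (dres _ m dh)) _.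
  rewrite !ger0_norm//; last lra.
  (* For [t = 0] strictness comes from the second point, otherwise from the first. *)
  have [->|tp] := eqVneq t 0; first by rewrite mul0r add0r subr0 mul1r.
  have := lt_neqAle 0 t; rewrite eq_sym tp t_ge0 /= => tpos; nra.
- exists (t1, t2); split=> //; split=> //; exists 1; first by rewrite ler01 lexx.
  by apply: dz => v; rewrite /res /g /dsub /=; ring.
- split=> //; exists 0; first by rewrite lexx ler01.
  by apply: dz => v; rewrite /res; ring.
move=> [s f] Gs [/= df [l l01 lt]].
have dr := dres _ l df.
have dfE : dsub f ws = fun v => l * g v + res f l v.
  by apply/funext => v; rewrite /dsub /res; ring.
have := no _ Gs; rewrite /= dfE bidualD//; last exact: is_dual_scale.
rewrite bidualZ// -gw (dualB dg) (dualB dr).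
have := wC _ dr; rewrite ler_norml => /andP[b1 _].
have b2 := dual_le w dr.
have : dnorm (res f l) * (`|C| + `|w| + 1) < e.
  by rewrite -ltr_pdivlMr.
have := ler_wpM2r (dnorm_ge0 (res f l)) (ler_norm C).
have := dnorm_ge0 (res f l).
nra.
Qed.

End equivalences.

(** * A penalty whose conjugate is finite only on a tube *)

Section penalty.
Variables (R : realType) (E : normedModType R).
Implicit Types (phi tau : E -> R) (x y : E) (delta : R).

(* The conjugate at [phi] is the least [l] in [0, 1] such that [phi] is within
   [delta] of [l * tau]; it is infinite off the [delta]-tube around [[0, tau]]. *)
Definition tube_penalty delta tau x : R := delta * `|x| + Num.max 0 (tau x - 1).

Lemma tube_penalty_ge0 delta tau x : 0 <= delta -> 0 <= tube_penalty delta tau x.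
Proof. by move=> d0; rewrite addr_ge0 ?mulr_ge0// le_max lexx. Qed.

Lemma tube_penalty_convex delta tau x y t : 0 <= delta -> is_dual tau ->
  0 <= t <= 1 -> tube_penalty delta tau (t *: x + (1 - t) *: y) <=
    t * tube_penalty delta tau x + (1 - t) * tube_penalty delta tau y.
Proof.
move=> d0 dtau /andP[t_ge0 t_le1]; rewrite /tube_penalty (dualD dtau) !(dualZ dtau).
have t1 : 0 <= 1 - t by lra.
have : `|t *: x + (1 - t) *: y| <= t * `|x| + (1 - t) * `|y|.
  by rewrite (le_trans (ler_normD _ _))// !normrZ !ger0_norm.
move=> /(ler_wpM2l d0) hn.
have hx : tau x - 1 <= Num.max 0 (tau x - 1) by rewrite le_max lexx orbT.
have hy : tau y - 1 <= Num.max 0 (tau y - 1) by rewrite le_max lexx orbT.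
have hx0 : 0 <= Num.max 0 (tau x - 1) by rewrite le_max lexx.
have hy0 : 0 <= Num.max 0 (tau y - 1) by rewrite le_max lexx.
have : Num.max 0 (t * tau x + (1 - t) * tau y - 1) <=
    t * Num.max 0 (tau x - 1) + (1 - t) * Num.max 0 (tau y - 1).
  rewrite ge_max addr_ge0 ?mulr_ge0//=.
  have := ler_wpM2l t_ge0 hx; have := ler_wpM2l t1 hy; lra.
lra.
Qed.

Lemma tube_penalty_anchor delta tau phi : is_dual tau -> is_dual phi ->
  dnorm (dsub phi tau) <= delta -> conj_le (tube_penalty delta tau) phi 1.
Proof.
move=> dtau dphi le y; rewrite /tube_penalty.
have hy : tau y - 1 <= Num.max 0 (tau y - 1) by rewrite le_max lexx orbT.
have := dual_le y (is_dual_dsub dphi dtau).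
have := ler_wpM2r (normr_ge0 y) le; rewrite {2}/dsub; lra.
Qed.

(** The inequality at [m^-1 *: y], multiplied by [m], leaves the recession function of the penalty
    as [m] tends to [0]. *)
Lemma tube_penalty_recession delta tau phi k : is_dual tau -> is_dual phi ->
  conj_le (tube_penalty delta tau) phi k ->
  forall y, phi y <= delta * `|y| + Num.max 0 (tau y).
Proof.
move=> dtau dphi le y; apply: (@le_of_small _ _ _ k) => m m0.
have := le (m^-1 *: y).
rewrite /tube_penalty (dualZ dphi) (dualZ dtau) normrZ gtr0_norm ?invr_gt0//.
move=> /(ler_wpM2l (ltW m0)); rewrite !mulrBr mulrDr mulVKf ?gt_eqF//.
rewrite mulrCA mulVKf ?gt_eqF//.
have : m * Num.max 0 (m^-1 * tau y - 1) <= Num.max 0 (tau y).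
  rewrite (maxr_pMr _ _ (ltW m0)) mulr0 mulrBr mulVKf ?gt_eqF// ge_max le_max lexx/=.
  by rewrite le_max; apply/orP; right; lra.
lra.
Qed.

(* One-dimensional Helly argument: each [y] confines [l] to a half-line, and
   any two of these half-lines meet since a positive combination of the two
   vectors lies in the kernel of [tau]. *)
Lemma tube_multiplier delta tau phi : 0 <= delta -> is_dual tau -> is_dual phi ->
  (forall y, phi y <= delta * `|y| + Num.max 0 (tau y)) ->
  exists2 l, 0 <= l <= 1 & dnorm (fun y => phi y - l * tau y) <= delta.
Proof.
move=> d0 dtau dphi le.
pose q y := phi y - delta * `|y|.
have qle y : q y <= Num.max 0 (tau y) by rewrite /q; have := le y; lra.
(* The lower constraints on [l], with [0] added to force [0 <= l]; the supremum is the least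
   candidate. *)
pose A := [set l | l = 0 \/ exists2 x, 0 < tau x & l = q x / tau x].
have A1 : ubound A 1.
  move=> _ [->//|[x tx ->]]; rewrite ler_pdivrMr// mul1r.
  by have := qle x; rewrite max_r// ltW.
have hA : has_sup A by split; [exists 0; left|exists 1].
pose l := sup A.
have l0 : 0 <= l by apply: ub_le_sup; [case: hA|left].
have l1 : l <= 1 by apply: ge_sup; [case: hA|].
have main y : q y <= l * tau y.
  have [ty|ty|ty] := ltrgt0P (tau y).
  - rewrite -ler_pdivrMr//; apply: ub_le_sup; first by case: hA.
    by right; exists y.
  - have qy : q y <= 0 by have := qle y; rewrite max_l// ltW.
    suff : l <= q y / tau y by rewrite -[q y / _]mulrNN -invrN ler_pdivlMr ?oppr_gt0//; lra.
    apply: ge_sup; first by case: hA.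
    move=> _ [->|[x tx ->]].
      by rewrite -mulrNN -invrN divr_ge0// ?oppr_ge0// ltW.
    have nty : 0 < - tau y by rewrite oppr_gt0.
    rewrite -[leRHS]mulrNN -invrN ler_pdivlMr// mulrAC ler_pdivrMr//.
    have tz : tau ((- tau y) *: x + tau x *: y) = 0.
      by rewrite (dualD dtau) !(dualZ dtau); ring.
    have := qle ((- tau y) *: x + tau x *: y); rewrite tz maxxx /q.
    rewrite (dualD dphi) !(dualZ dphi).
    have : `|(- tau y) *: x + tau x *: y| <= - tau y * `|x| + tau x * `|y|.
      by rewrite (le_trans (ler_normD _ _))// !normrZ !gtr0_norm.
    move=> /(ler_wpM2l d0); lra.
  - by have := qle y; rewrite ty maxxx mulr0.
exists l; first by rewrite l0.
apply: dnorm_le_bound => //; apply: linear_form_bound => [a x y|x x1].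
  by rewrite (dualD dphi) (dualZ dphi) (dualD dtau) (dualZ dtau); ring.
have := main x; rewrite /q; have := ler_wpM2l d0 x1; lra.
Qed.

End penalty.

(** * From condition (c) to quasidensity *)

Section quasidense.
Variables (R : realType) (E : completeNormedModType R).
Variable G : set (E * (E -> R)).
Hypothesis maxG : maximally_monotone G.
Hypothesis nG : neg_inf G.

(** A near-minimiser on the cone is moved into [G] at distance [4 * a]. Monotonicity against a fixed
    point of [G] bounds the near-minimisers independently of [a], so the cost is of order [a]. *)
Lemma neg_inf_quasidense : quasidense G.
Proof.
have [[dG G0] [mG _]] := maxG; have [[s0 f0] Gs0] := G0.
move=> x xs dxs; apply/ereal_inf_le0P => e e0.
have df0 : is_dual f0 := dG _ Gs0.
pose M := `|x - s0| + dnorm (dsub xs f0).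
have M0 : 0 <= M by rewrite addr_ge0// dnorm_ge0.
(* The final value is at most [33 * a ^+ 2 + 8 * a * (Y + D)], and [Y + D <= 8 * M + 8]. *)
pose K := 33 + 8 * (8 * M + 8).
have K0 : 0 < K by rewrite /K; lra.
pose a := e / (e + K).
have a0 : 0 < a by rewrite divr_gt0// addr_gt0.
have eK : 0 < e + K by rewrite addr_gt0.
have a1 : a <= 1 by rewrite /a ler_pdivrMr// mul1r lerDl ltW.
have aK : a * K < e by rewrite /a mulrAC ltr_pdivrMr// ltr_pM2l//; lra.
have [|y [f [r [Ky gap le]]]] := @mcone_dense _ _ _ dG mG nG G0 x _ (a ^+ 2) dxs.
  by rewrite exprn_gt0.
have df := mcone_dual dG Ky.
have := mcone_gap dG mG Ky (mcone_gen Gs0).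
rewrite subrr addr0 => /le_trans/(_ gap) anchor.
have [s [g [Gs sy gf]]] := brondsted_rockafellar maxG nG Ky a0 gap.
have dg : is_dual g := dG _ Gs.
exists (s, g) => //=.
have dfx := is_dual_dsub df dxs; have dgf := is_dual_dsub dg df.
have dxf := is_dual_dsub dxs df0.
set Y := `|y - x| in le; set D := dnorm (dsub f xs) in le.
have Y0 : 0 <= Y by exact: normr_ge0.
  have D0 : 0 <= D by exact: dnorm_ge0.
(* Since [anchor] bounds the pairing from below, the squares in [le] are dominated by terms linear
   in [Y] and [D]. *)
have YD : Y + D <= 8 * M + 8.
  have eq1 : dsub f f0 (y - s0) = dsub f xs (y - x) + dsub f xs (x - s0)
     + dsub xs f0 (y - x) + dsub xs f0 (x - s0).
    by rewrite /dsub !(dualB df, dualB dxs, dualB df0); ring.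
  have := dual_le (x - s0) dfx; have := dual_le (y - x) dxf.
  have := dual_le (x - s0) dxf; rewrite -/Y -/D => h1 h2 h3.
  have aa : a ^+ 2 <= 1 by rewrite expr_le1// ltW.
  rewrite eq1 in anchor.
  have U0 := normr_ge0 (x - s0); have V0 := dnorm_ge0 (dsub xs f0).
  rewrite leNgt; apply/negP; rewrite /M.
  move: (`|x - s0|) (dnorm (dsub xs f0)) U0 V0 h1 h2 h3 => U W U0 W0 h1 h2 h3 lt.
  have : 1 / 2 * Y ^+ 2 + 1 / 2 * D ^+ 2 <= 2 + D * U + W * Y + W * U by lra.
  have := sqr_ge0 (Y - D).
  have : (Y + D - 8 * (U + W) - 8) * (Y + D) > 0 by rewrite mulr_gt0//; lra.
  have := mulr_ge0 U0 W0; have := mulr_ge0 U0 Y0; have := mulr_ge0 W0 D0.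
  have := mulr_ge0 U0 U0; have := mulr_ge0 W0 W0.
  have : (U + W) * (Y + D - 8 * (U + W) - 8) >= 0 by rewrite mulr_ge0//; lra.
  nra.
have n1 : `|s - x| <= Y + 4 * a.
  by rewrite (le_trans (ler_distD y _ _))// addrC lerD2l.
have n2 : dnorm (dsub g xs) <= D + 4 * a.
  by rewrite (le_trans (dnorm_triangle dg df dxs))// addrC lerD2l.
have -> : dsub g xs (s - x) = dsub f xs (y - x) + dsub f xs (s - y) + dsub g f (s - x).
  by rewrite /dsub !(dualB dg, dualB df, dualB dxs); ring.
have h1 : dsub f xs (s - y) <= D * (4 * a).
  by apply: le_trans (dual_le _ dfx) _; apply: ler_wpM2l.
have h2 : dsub g f (s - x) <= 4 * a * (Y + 4 * a).
  apply: le_trans (dual_le _ dgf) _.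
  by apply: ler_pM => //; exact: dnorm_ge0.
have h3 : `|s - x| ^+ 2 <= (Y + 4 * a) ^+ 2 by rewrite lerXn2r ?nnegrE//; lra.
have h4 : dnorm (dsub g xs) ^+ 2 <= (D + 4 * a) ^+ 2.
  by rewrite lerXn2r ?nnegrE// ?dnorm_ge0//; lra.
apply: le_lt_trans aK; rewrite /K.
have := ler_wpM2l (ltW a0) YD.
have : a * a <= a by rewrite ler_piMr// ltW.
lra.
Qed.

End quasidense.

(** * From condition (c) to type (FP) *)

Section type_FP.
Variables (R : realType) (E : completeNormedModType R).
Variable G : set (E * (E -> R)).
Hypothesis maxG : maximally_monotone G.
Hypothesis nG : neg_inf G.

(** For a near-minimiser [(x, phi)], the approximant in [G] lies in the tube, so [tube] gives
    [phi x >= - O(a)]. As [phi x <= r], both [k] and the penalty are [O(a)]; hence [x] is [O(a)] and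
    [- phi u <= delta * |u| + O(a)]. Monotonicity against the recentred [(u, h)] concludes. *)
Lemma tube_estimate w ws t1 t2 delta0 : is_dual ws -> G (t1, t2) -> 0 < delta0 ->
  (forall s g l, G (s, g) -> 0 <= l <= 1 ->
    dnorm (fun y => g y - ws y - l * (t2 y - ws y)) <= delta0 ->
    0 <= dsub g ws (s - w)) ->
  forall p, G p -> 0 <= dsub p.2 ws (p.1 - w).
Proof.
move=> dws Gt delta0_gt0 tube [u h] Gu /=.
have [[dG G0] [mG _]] := maxG.
pose G' := shift w ws G.
have dG' : dual_graph G' by exact: dual_graph_shift.
have mG' : Defs.monotone G' by exact: monotone_shift.
have nG' : neg_inf G' by exact: neg_inf_shift.
have Gshift s g : G (s, g) -> G' (s - w, dsub g ws).
  move=> Gs; rewrite /G' /shift /= subrK; move: Gs; congr (G (_, _)).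
  by apply/funext => y; rewrite /dsub subrK.
have dt2 : is_dual t2 := dG _ Gt.
have dtau := is_dual_dsub dt2 dws.
have dh : is_dual (dsub h ws) by apply: is_dual_dsub => //; exact: dG Gu.
have Gt' := Gshift _ _ Gt; have Gu' := Gshift _ _ Gu.
move: (dsub h ws) dh Gu' => {Gu}h dh Gu'.
move: (u - w) Gu' => {}u Gu'.
set tau := dsub t2 ws in dtau Gt'; set t := t1 - w in Gt'.
rewrite -oppr_le0.
apply: (@le_of_small _ _ _ `|u|) => m m0; rewrite add0r.
(* [delta] is fixed before [a], since the constants below depend on it. Half of [delta0] is kept for
   the error [4 * a] of the approximant. *)
pose delta := Num.min m (delta0 / 2).
have d_gt0 : 0 < delta by rewrite lt_min m0 divr_gt0.
have d_ge0 := ltW d_gt0.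
apply: (@le_trans _ _ (delta * `|u|)); last first.
  by apply: ler_wpM2r => //; rewrite ge_min lexx.
have d_le : delta <= delta0 / 2 by rewrite ge_min lexx orbT.
clearbody delta.
pose T := dnorm tau; have T0 : 0 <= T by exact: dnorm_ge0.
pose Q := `|tau t| + (T + delta) * `|t|.
have Q0 : 0 <= Q by rewrite addr_ge0// mulr_ge0// addr_ge0.
pose M := (2 + Q) / delta.
have M0 : 0 <= M by rewrite divr_ge0//; lra.
pose M3 := 1 + (4 * (T + delta) + 4 * (M + 4)).
have M30 : 0 <= M3 by rewrite /M3; lra.
pose M4 := 1 + dnorm h * (M3 / delta) + M3 * (T * `|u| + 1).
apply: (@le_of_small _ _ _ M4) => b b0.
have M40 : 0 <= M4.
  by rewrite /M4 !addr_ge0// mulr_ge0 ?dnorm_ge0// ?divr_ge0// addr_ge0// mulr_ge0.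
pose a := Num.min b (Num.min 1 (delta0 / 8)).
have a0 : 0 < a by rewrite !lt_min b0 ltr01 divr_gt0.
have ab : a <= b by rewrite ge_min lexx.
have a1 : a <= 1 by rewrite /a !ge_min lexx orbT.
have ad : a <= delta0 / 8 by rewrite /a !ge_min lexx !orbT.
apply: (@le_trans _ _ (delta * `|u| + a * M4)); last first.
  by rewrite lerD2l; apply: ler_wpM2r.
clearbody a => {b b0 ab}.
have aa : a ^+ 2 <= a by rewrite expr2 ler_piMr// ltW.
have bounded x : `|x| <= 1 -> tube_penalty delta tau x <= delta + T.
  move=> x1; rewrite /tube_penalty; apply: lerD; first by rewrite ler_piMr.
  rewrite ge_max T0/=; have := dual_le x dtau.
  have := ler_wpM2l T0 x1; rewrite -/T; lra.
have [x [phi [r [k [K ck le]]]]] := conjugate_duality dG' nG'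
  (fun x y t => tube_penalty_convex x y d_ge0 dtau) bounded Gt' d_gt0
  (fun phi dphi => tube_penalty_anchor dtau dphi) (exprn_gt0 2 a0).
have dphi := mcone_dual dG' K.
have rphi := mcone_monotone dG' mG' K K.
have jx := tube_penalty_ge0 tau (- x) d_ge0.
have k0 : 0 <= k.
  have := ck 0; rewrite /tube_penalty (dual0 dphi) (dual0 dtau) normr0 mulr0 sub0r.
  by rewrite max_l//; lra.
have gap : r - phi x <= a ^+ 2 by have := ck (- x); rewrite (dualN dphi); lra.
have [l l01 phil] := tube_multiplier d_ge0 dtau dphi
  (tube_penalty_recession dtau dphi ck).
have phiT : dnorm phi <= T + delta.
  have dl : is_dual (fun y => phi y - l * tau y).
    by exact: is_dual_dsub dphi (is_dual_scale _ dtau).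
  have -> : phi = fun y => 1 * (phi y - l * tau y) + l * tau y.
    by apply/funext => y; ring.
  apply: le_trans (dnorm_comb _ _ dl dtau) _.
  have /andP[l0 l1] := l01; rewrite normr1 mul1r ger0_norm// addrC.
  by apply: lerD => //; rewrite ler_piMl.
have [s [g [Gs sx gphi]]] : exists s g, [/\ G (s, g), `|s - w - x| <= 4 * a &
    dnorm (dsub (dsub g ws) phi) <= 4 * a].
  have Kw := mcone_shift dws dG K.
  have gapw : r + phi w + ws x + 1 * ws w - (phi (x + 1 *: w) + 1 * ws (x + 1 *: w))
      <= a ^+ 2.
    by rewrite scale1r !mul1r (dualD dphi) (dualD dws); lra.
  have [s [g [Gs sx gphi]]] := brondsted_rockafellar maxG nG Kw a0 gapw.
  exists s, g; split => //; first by rewrite -addrA -opprD [w + x]addrC -[w]scale1r.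
  suff <- : dsub g (fun y => phi y + 1 * ws y) = dsub (dsub g ws) phi by [].
  by apply/funext => y; rewrite /dsub; ring.
have dg := is_dual_dsub (dG _ Gs : is_dual g) dws.
have dgp := is_dual_dsub dg dphi.
have pos : 0 <= dsub g ws (s - w).
  apply: (tube _ _ l Gs l01).
  have -> : (fun y => g y - ws y - l * (t2 y - ws y)) =
      fun y => 1 * dsub (dsub g ws) phi y + 1 * (phi y - l * tau y).
    by apply/funext => y; rewrite /tau /dsub; ring.
  apply: le_trans (dnorm_comb _ _ dgp _) _.
    by exact: is_dual_dsub dphi (is_dual_scale _ dtau).
  by rewrite normr1 !mul1r; lra.
have [dx0 mx] : delta * `|x| <= tube_penalty delta tau (- x) /\
    delta * `|x| - tau x - 1 <= tube_penalty delta tau (- x).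
  rewrite /tube_penalty normrN (dualN dtau); split.
    by rewrite lerDl le_max lexx.
  by rewrite -addrA lerD2l le_max lexx orbT.
(* Monotonicity against [(t, tau)] absorbs the [tau x] in the lower bound [mx] of the penalty. *)
have xM : `|x| <= M.
  rewrite ler_pdivlMr// mulrC.
  have := mcone_monotone dG' mG' K (mcone_gen Gt'); rewrite !mulr1.
  have := dual_ge t dphi; have := ler_wpM2r (normr_ge0 t) phiT.
  have := ler_norm (tau t); rewrite /Q; lra.
have phix : - (a * (4 * (T + delta) + 4 * (M + 4))) <= phi x.
  have e1 : dsub g ws (s - w) = phi x + phi (s - w - x) +
      dsub (dsub g ws) phi (s - w).
    by rewrite (dualB dphi) /dsub; ring.
  have n1 : `|s - w| <= M + 4.
    rewrite -[s - w](subrK x) (le_trans (ler_normD _ _))//; lra.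
  have := dual_le (s - w - x) dphi.
  have := dual_le (s - w) dgp.
  have : dnorm (dsub (dsub g ws) phi) * `|s - w| <= 4 * a * (M + 4).
    by apply: ler_pM => //; exact: dnorm_ge0.
  have : dnorm phi * `|s - w - x| <= (T + delta) * (4 * a).
    by apply: ler_pM => //; exact: dnorm_ge0.
  rewrite e1 in pos; lra.
have small : k + tube_penalty delta tau (- x) <= a * M3 by rewrite /M3; lra.
have hx : - h x <= dnorm h * (a * M3 / delta).
  have := dual_ge x dh; suff : dnorm h * `|x| <= dnorm h * (a * M3 / delta) by lra.
  by apply: ler_wpM2l; [exact: dnorm_ge0|rewrite ler_pdivlMr// mulrC; lra].
have phiu : - phi u <= a * M3 * (T * `|u| + 1) + delta * `|u|.
  (* Dividing [u] by [c] keeps [tau] at most [1] at the test point, so the maximum in the penalty is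
     [0]. *)
  pose c := T * `|u| + 1; have c0 : 0 < c by rewrite ltr_wpDl// mulr_ge0.
  have := ck (- (c^-1 *: u)).
  rewrite /tube_penalty normrN normrZ gtr0_norm ?invr_gt0//.
  rewrite (dualN dphi) (dualN dtau) (dualZ dphi) (dualZ dtau) max_l; last first.
    have := dual_ge u dtau; rewrite -/T => tu.
    suff : - (c^-1 * tau u) <= 1 by lra.
    by rewrite -mulrN mulrC ler_pdivrMr// mul1r /c; lra.
  rewrite addr0 => /(ler_wpM2l (ltW c0)).
  rewrite mulrBr mulrN mulVKf ?gt_eqF// mulrCA mulVKf ?gt_eqF//.
  have : c * k <= c * (a * M3) by apply: ler_wpM2l; [exact: ltW|lra].
  rewrite /c; lra.
have := mcone_monotone dG' mG' K (mcone_gen Gu'); rewrite !mulr1.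
rewrite /M4; lra.
Qed.

Lemma neg_inf_type_FP : type_FP G.
Proof.
move=> U dU oU cU [[t1 t2] [Gt Ut]] w ws Uws pos.
have dws := dU _ Uws; have dt : is_dual t2 := dU _ Ut.
apply: maximally_monotone_mem => //.
have [d1 d1_gt0 U1] := oU _ Uws; have [d2 d2_gt0 U2] := oU _ Ut.
have d_gt0 : 0 < Num.min d1 d2 / 2 by rewrite divr_gt0// lt_min d1_gt0.
apply: (tube_estimate dws Gt d_gt0) => s g l Gs l01 le.
apply: (pos (s, g) Gs) => /=.
have dg : is_dual g by have [[dG _] _] := maxG; exact: dG Gs.
pose v y := g y - ws y - l * (t2 y - ws y).
have dv : is_dual v.
  exact: is_dual_dsub (is_dual_dsub dg dws) (is_dual_scale _ (is_dual_dsub dt dws)).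
have lt f : dnorm (dsub (fun y => f y + v y) f) < Num.min d1 d2.
  have -> : dsub (fun y => f y + v y) f = v.
    by apply/funext => y; rewrite /dsub addrC addKr.
  apply: le_lt_trans le _; have : 0 < Num.min d1 d2 by rewrite lt_min d1_gt0.
  lra.
(* Both ends of the segment are moved by the same deviation [v]; they stay in [U], and convexity
   gives [g]. *)
have -> : g = fun y => l * (t2 y + v y) + (1 - l) * (ws y + v y).
  by apply/funext => y; rewrite /v; ring.
apply: cU => //.
- apply: U2; first exact: is_dual_add.
  by apply: lt_le_trans (lt _) _; rewrite ge_min lexx orbT.
- apply: U1; first exact: is_dual_add.
  by apply: lt_le_trans (lt _) _; rewrite ge_min lexx.
Qed.

End type_FP.

(** * The equivalences, through condition (c) *)

Unset Implicit Arguments.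

Theorem theorem8p3 (R : realType) (E : completeNormedModType R)
  (G : set (E * (E -> R))) :
  (exists x : E, x != 0) ->
  maximally_monotone G ->
  (quasidense G <-> type_FP G) /\ (type_FP G <-> cond_c G).
Proof.
move=> _ maxG; have [[dG G0] _] := maxG.
have qn : quasidense G -> neg_inf G by exact: quasidense_neg_inf.
have fn : type_FP G -> neg_inf G by exact: type_FP_neg_inf.
have nq := neg_inf_quasidense maxG.
have nf := neg_inf_type_FP maxG.
split; split.
- by move=> /qn.
- by move=> /fn.
- by move=> /fn/cond_c_neg_inf.
- by move=> /cond_c_neg_inf.
Qed.
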